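(* Let $N\ge10^4$, let $\mathcal{B}$ be a $\delta$-well spaced subset of $\mathbb{R}/\mathbb{Z}$ and let $f$ be a complex-valued function on $\mathcal{B}$, not identically zero. Then $$\sum_{p\le N}\Bigl|\sum_{b\in\mathcal{B}}f(b)e(bp)\Bigr|^2\le 19(N+\delta^{-1})\|f\|_2^2\,\frac{\log(2\|f\|_1^2/\|f\|_2^2)}{\log N},$$ where the outer sum is over primes and $\|f\|_q^q=\sum_{b\in\mathcal{B}}|f(b)|^q$.
   Context: $e(x)=e^{2\pi ix}$. A set $\mathcal{B}\subset\mathbb{R}/\mathbb{Z}$ is $\delta$-well spaced if any two distinct points of it are at distance $\ge\delta$ in $\mathbb{R}/\mathbb{Z}$. *)

(* Defs.v *)
From HB Require Import structures.
From mathcomp Require Import all_boot all_order all_algebra.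
From mathcomp Require Import all_classical all_reals all_analysis.
From mathcomp Require Import complex.

Set Implicit Arguments.
Unset Strict Implicit.
Unset Printing Implicit Defensive.

Import Order.TTheory GRing.Theory Num.Theory.
Import numFieldNormedType.Exports.

Local Open Scope classical_set_scope.
Local Open Scope ring_scope.
Local Open Scope quotient_scope.
Local Open Scope complex_scope.

Definition circle (R : realType) : Type :=
  {ideal_quot (Num.int_num_subdef : {pred R})}.

HB.instance Definition _ (R : realType) := GRing.Zmodule.on (circle R).
HB.instance Definition _ (R : realType) := ZmodQuotient.on (circle R).

Section Definitions.
Context {R : realType}.
Implicit Types (t : R) (x y : circle R) (B : set (circle R)).

Definition toCircle t : circle R := \pi_(circle R) t.

Definition circle_dist x y : R :=
  inf [set `|s - t| | s in toCircle @^-1` [set x] & t in toCircle @^-1` [set y]].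

Definition well_spaced (delta : R) B : Prop :=
  forall x y, B x -> B y -> x != y -> delta <= circle_dist x y.

Definition expi t : R[i] := cos (2 * pi * t) +i* sin (2 * pi * t).

(* [expi] has period 1 (see [e_toCircle]), so the choice made by [repr] is
   immaterial. *)
Definition e x : R[i] := expi (repr x).

(* [\sum_(b \in B)] is the sum over a finite set; it takes the junk value 0 on
   infinite supports, which cannot occur when [B] is [delta]-well spaced with
   [0 < delta], since [B] is then finite. *)
Definition lnorm (q : R) B (f : circle R -> R[i]) : R :=
  (\sum_(b \in B) Normc.normc (f b) `^ q) `^ q^-1.

End Definitions.

Section Facts.
Context {R : realType}.
Implicit Types (s t : R) (x y : circle R) (B : set (circle R)).

Lemma toCircle_eq s t : toCircle s = toCircle t <-> exists n : int, s - t = n%:~R.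
Proof.
split.
  move=> /eqP; rewrite -Quotient.idealrBE => /intrP[n ->]; by exists n.
move=> [n st]; apply/eqP; rewrite -Quotient.idealrBE st; exact: intr_int.
Qed.

Lemma toCircleMn t n : toCircle t *+ n = toCircle (t *+ n).
Proof. by rewrite /toCircle raddfMn. Qed.

Lemma expiD s t : expi (s + t) = expi s * expi t.
Proof.
by rewrite /expi mulrDr cosD sinD; apply/eqP; rewrite eq_complex /= addrC eqxx /=
  [in X in _ == X]addrC addrC eqxx.
Qed.

Lemma expi_nat n : expi (n%:R : R) = 1.
Proof.
have -> : expi (n%:R : R) = expi (0 + n%:R) by rewrite add0r.
rewrite /expi mulrDr mulr0 mulr_natr mulr_natl.
by rewrite (periodicn (@cosD2pi R)) (periodicn (@sinD2pi R)) cos0 sin0.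
Qed.

Lemma expi_int (n : int) : expi (n%:~R : R) = 1.
Proof.
case: n => n; first exact: expi_nat.
have := expiD (Negz n)%:~R n.+1%:R.
by rewrite NegzE mulrNz addNr expi_nat mulr1 -(expi_nat 0) => <-.
Qed.

Lemma e_toCircle t : e (toCircle t) = expi t.
Proof.
have /toCircle_eq[n h] : toCircle (repr (toCircle t)) = toCircle t.
  by rewrite /toCircle reprK.
by rewrite /e -(subrK t (repr _)) h expiD expi_int mul1r.
Qed.

Lemma lnorm1 B (f : circle R -> R[i]) :
  lnorm 1 B f = \sum_(b \in B) Normc.normc (f b).
Proof.
have n0 z : 0 <= Normc.normc z :> R by case: z => a b; exact: sqrtr_ge0.
rewrite /lnorm invr1 powRr1; last by apply: fsumr_ge0 => b _; exact: powR_ge0.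
by apply: eq_fsbigr => b _; rewrite powRr1.
Qed.

Lemma sqr_lnorm2 B (f : circle R -> R[i]) :
  lnorm 2 B f ^+ 2 = \sum_(b \in B) Normc.normc (f b) ^+ 2.
Proof.
have n0 z : 0 <= Normc.normc z :> R by case: z => a b; exact: sqrtr_ge0.
rewrite /lnorm -powR_mulrn ?powR_ge0// -powRrM mulVf ?pnatr_eq0// powRr1.
  by apply: eq_fsbigr => b _; rewrite powR_mulrn.
by apply: fsumr_ge0 => b _; exact: powR_ge0.
Qed.

End Facts.

(* Main.v *)
Require Import Defs.
From HB Require Import structures.
From mathcomp Require Import all_boot all_order all_algebra.
From mathcomp Require Import all_classical all_reals all_analysis.
From mathcomp Require Import complex.
From mathcomp Require Import ring lra zify.

Import Order.TTheory GRing.Theory Num.Theory.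
Import numFieldNormedType.Exports.

Local Open Scope ring_scope.

(* Put S(n) = sum_b f(b) e(b n) and K = ||f||_1^2 / ||f||_2^2.  If K is bounded, the trivial bound
   |S(p)| <= ||f||_1 and Chebyshev's estimate for the number of primes suffice;
   if K exceeds a power of N, the large sieve suffices.  In between, let P be the
   set of the primes in (y, z], where y is comparable to K and z = N^(21/100), and let
   h(n) be the sum of mu(d) c_d(n) / phi(d) over the squarefree d <= z composed of
   primes of P, where c_d is the Ramanujan sum.  For a prime n > z, h(n) is the
   constant G, the sum of the 1 / phi(d), so that G^2 times the sum over p > z
   is at most the sum of h(n)^2 |S(n)|^2 over n <= N.
   The mean value of h^2 is G, and its Fourier coefficients at the nonzero
   frequencies are all O(G / y), because their denominators have a prime factor
   exceeding y.  Hence the sum of h^2 |S|^2 is G times the plain large sieve sum,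
   up to an error O(G N / y) ||f||_1^2 = O(G N) ||f||_2^2.  Dividing by G^2 and
   using Mertens' theorem, in the form that G exceeds a constant times
   log z / log y, gives the bound. *)

(** Spacing does not keep a difference b - b' away from fractions with small denominator, so the
    nonzero Fourier coefficients of h^2 have to be bounded uniformly. Summing over all pairs then
    costs ||f||_1^2 = K ||f||_2^2, which only the factor 1 / y can repay; hence y of order K, and
    hence the removal of the primes up to y. As G is then at least of order log N / log K, dividing
    the large sieve by G gains exactly the quotient of logarithms in the theorem. The exponent of z
    comes from the error terms. In h^2 the moduli reach z^2 and the coefficients add up to about z^2
    G^2, so after division by G^2 the error is about K z^4 ||f||_2^2 and has to stay a power of N
    below N. The large sieve alone yields the constant 19 once 2 K exceeds N^(61/950), because 19 *
    61 / 950 = 61 / 50; below that, 4 * 21 / 100 + 61 / 950 < 1 leaves the power N^(91/950) to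
    spare. *)

(** * Chebyshev's bounds for the primes *)

Section Chebyshev.
Context {R : realType}.
Implicit Types (n m d p k : nat).

Lemma le_ln_Bln (x y : R) : 0 < x -> 0 < y -> ln y - ln x <= (y - x) / x.
Proof.
move=> x0 y0; rewrite -ln_div ?posrE//.
have -> : y / x = 1 + (y - x) / x by field; apply: lt0r_neq0.
by apply: le_ln1Dx; rewrite mulrBl divff ?lt0r_neq0// ltrBrDr addNr divr_gt0.
Qed.

Lemma ln_fact_ge n : n%:R * ln n%:R - n%:R <= ln (n`!%:R : R).
Proof.
elim: n => [|n IH]; first by rewrite mul0r /= ln1 subr0.
rewrite factS natrM lnM ?posrE ?ltr0n ?fact_gt0//.
case: n IH => [|n] IH; first by rewrite /= mulr1n ln1; lra.
have h : n.+1%:R * (ln n.+2%:R - ln n.+1%:R) <= (1 : R).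
  have := @le_ln_Bln n.+1%:R n.+2%:R; rewrite !ltr0n => /(_ isT isT).
  have -> : (n.+2%:R - n.+1%:R : R) = 1 by rewrite -natrB// subSnn.
  by rewrite mul1r -(ler_pM2l (_ : 0 < n.+1%:R)) ?ltr0n// divff// pnatr_eq0.
move: IH h; rewrite -[n.+2%:R]natr1; move: (ln _) (ln _) (ln _) => a b c; lra.
Qed.

Lemma ln_fact_le n : (0 < n)%N ->
  ln (n`!%:R : R) <= n%:R * ln n%:R - n%:R + 1 + ln n%:R.
Proof.
elim: n => // -[|n] IH _; first by rewrite /= mulr1n ln1; lra.
rewrite factS natrM lnM ?posrE ?ltr0n ?fact_gt0//.
have h : 1 <= n.+2%:R * (ln n.+2%:R - ln n.+1%:R) :> R.
  have := @le_ln_Bln n.+2%:R n.+1%:R; rewrite !ltr0n => /(_ isT isT).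
  have -> : (n.+1%:R - n.+2%:R : R) = -1 by rewrite -[n.+2%:R]natr1; lra.
  rewrite mulN1r lerNr opprB => h.
  by rewrite -(ler_pM2l (_ : 0 < n.+2%:R)) ?ltr0n// divff ?pnatr_eq0 in h.
move: (IH isT) h; rewrite -[n.+2%:R]natr1; move: (ln _) (ln _) (ln _) => a b c; lra.
Qed.

(* The bound [B] makes the sum finite: the value is the right one for [d < B]. *)
Definition vonMangoldt (B d : nat) : R :=
  \sum_(0 <= p < B | prime p) \sum_(1 <= k < B) (if (p ^ k == d)%N then ln p%:R else 0).

Lemma ln_nat_ge0 n : 0 <= ln (n%:R : R).
Proof. by case: n => [|n]; [rewrite ln0|apply: ln_ge0; rewrite ler1n]. Qed.

Lemma vonMangoldt_ge0 B d : 0 <= vonMangoldt B d.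
Proof.
apply: sumr_ge0 => p _; apply: sumr_ge0 => k _; case: ifP => // _.
exact: ln_nat_ge0.
Qed.

Lemma vonMangoldt_prime B p : prime p -> (p < B)%N -> ln p%:R <= vonMangoldt B p.
Proof.
move=> pp pB; rewrite /vonMangoldt big_mkcond (bigD1_seq p) ?mem_index_iota ?iota_uniq//=.
have lnk q k : 0 <= (if (q ^ k == p)%N then ln q%:R else 0 : R).
  by case: ifP => // _; exact: ln_nat_ge0.
rewrite pp ler_wpDr//.
  by apply: sumr_ge0 => q _; case: ifP => // _; apply: sumr_ge0 => k _.
rewrite (bigD1_seq 1%N) ?mem_index_iota ?iota_uniq//=; last first.
  by rewrite (leq_ltn_trans _ pB) ?prime_gt0.
by rewrite expn1 eqxx ler_wpDr//; apply: sumr_ge0 => k _.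
Qed.

Lemma sum_vonMangoldt B n (g : nat -> R) : (n < B)%N ->
  \sum_(1 <= d < n.+1) vonMangoldt B d * g d =
  \sum_(0 <= p < B | prime p) \sum_(1 <= k < B)
    (if (p ^ k <= n)%N then ln p%:R * g (p ^ k)%N else 0).
Proof.
move=> nB; under eq_bigr => d _ do rewrite mulr_suml.
rewrite exchange_big /=; apply: eq_bigr => p pp.
under eq_bigr => d _ do rewrite mulr_suml.
rewrite exchange_big /=; apply: eq_bigr => k _.
have pk0 : (0 < p ^ k)%N by rewrite expn_gt0 prime_gt0.
under eq_bigr => d _ do rewrite (fun_if (fun x => x * g d)) mul0r.
rewrite -big_mkcond /=; case: ifPn => [le|]; last first.
  rewrite -ltnNge => lt; rewrite big_nat_cond big_pred0// => d.
  by case: eqP => [<-|]; rewrite ?andbF// ltnS andbT (leqNgt _ n) lt andbF.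
rewrite big_mkcond (bigD1_seq (p ^ k)%N) ?iota_uniq//= ?mem_index_iota ?pk0 ?ltnS//.
by rewrite eqxx big1 ?addr0// => d; rewrite eq_sym => /negbTE ->.
Qed.

Lemma ln_sum_logn B n : (0 < n < B)%N ->
  ln (n%:R : R) = \sum_(0 <= p < B | prime p) (logn p n)%:R * ln p%:R.
Proof.
case: B => [|B]; first by rewrite ltn0 andbF.
move=> /andP[n0 nB]; rewrite -{1}(partnT n0) (widen_partn predT (nB : (n <= B)%N)) /=.
rewrite natr_prod big_mkcond [RHS]big_mkcond /=.
have : forall r, ln (\prod_(i <- r) (i ^ logn i n)%:R : R) = 
   \sum_(i <- r) (if prime i then (logn i n)%:R * ln i%:R else 0) /\ 
   0 < \prod_(i <- r) (i ^ logn i n)%:R :> R.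
  elim=> [|p r [IH1 IH2]]; first by rewrite !big_nil ln1.
  have p0 : (0 < p ^ logn p n)%N.
    have [pp|pp] := boolP (prime p); first by rewrite expn_gt0 prime_gt0.
    by rewrite lognE (negbTE pp).
  rewrite !big_cons lnM ?posrE ?ltr0n// IH1; split; last by rewrite mulr_gt0 ?ltr0n.
  congr +%R; case: ifP => pp; last by rewrite lognE pp ln1.
  by rewrite natrX lnXn ?ltr0n ?prime_gt0// mulr_natl.
by move=> /(_ (index_iota 0 B.+1))[-> _].
Qed.

(** Chebyshev's identity: Legendre's formula for the exponent of each prime in n!, regrouped by
    prime powers. *)
Lemma ln_fact_vonMangoldt B n : (n < B)%N ->
  ln (n`!%:R : R) = \sum_(1 <= d < n.+1) vonMangoldt B d * (n %/ d)%:R.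
Proof.
move=> nB; rewrite sum_vonMangoldt//.
transitivity (\sum_(0 <= p < B | prime p) (logn p n`!)%:R * ln (p%:R : R)).
  elim: n nB => [|n IH] nB.
    by rewrite /= ln1 big1// => p _; rewrite logn1 mul0r.
  rewrite factS natrM lnM ?posrE ?ltr0n ?fact_gt0// (@ln_sum_logn B)//.
  rewrite IH ?(ltnW nB)// -big_split; apply: eq_bigr => p _ /=.
  by rewrite lognM ?fact_gt0// natrD mulrDl.
apply: eq_bigr => p pp; rewrite logn_fact// natr_sum mulr_suml.
rewrite [RHS](big_cat_nat (n := n.+1)) //= [X in _ = _ + X]big_nat [X in _ = _ + X]big1 ?addr0.
  rewrite !big_nat; apply: eq_bigr => k _; case: leqP => h; first by rewrite mulrC.
  by rewrite divn_small// mul0r.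
move=> k /andP[nk _]; rewrite leqNgt (leq_trans nk) //.
by rewrite ltnW// ltn_expl// prime_gt1.
Qed.

(** For [n < B] this is Chebyshev's function, the logarithm of lcm(1, ..., n). *)
Definition psi B n : R := \sum_(1 <= d < n.+1) vonMangoldt B d.

(** For odd n = 2 m + 1 the equal coefficients C(n, m) and C(n, m + 1) both occur in the expansion
    of 2^n, which saves the factor 2 lost in [n./2]. *)
Lemma bin_half_le n : ('C(n, n./2) <= 4 ^ n./2)%N.
Proof.
have h m j : ('C(m, j) <= 2 ^ m)%N.
  have [jm|jm] := leqP j m; last by rewrite bin_small.
  rewrite -[X in (X ^ m)%N]/(1 + 1)%N expnDn (bigD1 (Ordinal (jm : (j < m.+1)%N)))//=.
  by rewrite !exp1n !muln1 leq_addr.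
have [on|en] := boolP (odd n).
  have nE : n = n./2.*2.+1 by rewrite -[LHS]odd_double_half on.
  set m := n./2 in nE *; rewrite nE.
  have hs : (2 * 'C(m.*2.+1, m) <= 2 ^ m.*2.+1)%N.
    rewrite -[X in (_ <= X ^ _)%N]/(1 + 1)%N expnDn.
    have mm : (m < m.*2.+2)%N by lia.
    have mm1 : (m.+1 < m.*2.+2)%N by lia.
    rewrite (bigD1 (Ordinal mm))// (bigD1 (Ordinal mm1))//=; last first.
      by rewrite -val_eqE /= eqn_leq ltnn.
    rewrite !exp1n !muln1 -(bin_sub (_ : m <= m.*2.+1)%N); last by lia.
    rewrite (_ : (m.*2.+1 - m = m.+1)%N); last by lia.
    by rewrite addnA -{1}mul2n leq_addr || (rewrite mul2n -addnn addnA leq_addr).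
  rewrite -(leq_pmul2l (_ : 0 < 2)%N)//; apply: leq_trans hs _.
  by rewrite expnS leq_pmul2l// -mul2n expnM.
rewrite (_ : (4 = 2 ^ 2)%N)// -expnM.
have nE : n = n./2.*2 by rewrite -[LHS]odd_double_half (negbTE en).
by rewrite [X in (_ <= 2 ^ X)%N](_ : _ = n) ?h// [RHS]nE -muln2 mulnC.
Qed.

(* Erdős' induction for the primorial works verbatim for the lcm. *)
Lemma psi_le B n : (n < B)%N -> psi B n <= n%:R * ln 4.
Proof.
have [m] := ubnP n; elim: m n => // m IH n; rewrite ltnS => nm nB.
have l4 : 0 <= ln (4 : R) by apply: ln_ge0; lra.
have [n2|n2] := leqP n 1.
  case: n n2 {nm nB} => [|[|//]] _; rewrite /psi; first by rewrite big_geq// mul0r.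
  rewrite big_nat1 mul1r; apply: le_trans l4.
  rewrite /vonMangoldt big1// => p pp; rewrite big_nat big1// => k /andP[k1 _].
  case: eqP => // e; have := ltn_expl k (prime_gt1 pp); rewrite e; lia.
set a := n./2; set b := uphalf n.
have nab : n = (a + b)%N by rewrite /a /b uphalf_half addnCA addnn odd_double_half.
have ab : (a <= b)%N by rewrite /a/b uphalf_half leq_addl.
have bn : (b < n)%N.
  have : (0 < a)%N by rewrite /a half_gt0.
  by lia.
(* By [ln_fact_vonMangoldt] the right side weights [vonMangoldt B d] by n / d - a / d - b / d
   (integer quotients), which is never negative and is at least 1 for b < d <= n, where the last two
   quotients vanish. *)
have h1 : psi B n - psi B b <= ln ('C(n, a)%:R : R).
  have -> : ln ('C(n, a)%:R : R) = ln (n`!%:R) - ln (a`!%:R) - ln (b`!%:R).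
    have an : (a <= n)%N by rewrite nab leq_addr.
    have := bin_fact an; rewrite {1}(_ : (n - a = b)%N); last by lia.
    move/(congr1 (fun j => ln (j%:R : R))).
    rewrite !natrM !lnM ?posrE ?ltr0n ?muln_gt0 ?fact_gt0 ?bin_gt0//.
    by move=> <-; ring.
  rewrite (@ln_fact_vonMangoldt B n)// (@ln_fact_vonMangoldt B a) ?(@ln_fact_vonMangoldt B b); [|by lia..].
  have ext c : (c <= n)%N -> \sum_(1 <= d < c.+1) vonMangoldt B d * (c %/ d)%:R =
     \sum_(1 <= d < n.+1) vonMangoldt B d * (c %/ d)%:R.
    move=> cn; rewrite [RHS](big_cat_nat (n := c.+1))//= [X in _ = _ + X]big_nat.
    by rewrite [X in _ = _ + X]big1 ?addr0// => d /andP[cd _]; rewrite divn_small// mulr0.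
  rewrite (ext a) ?(ext b); [|by lia..].
  have -> : psi B n - psi B b = \sum_(1 <= d < n.+1) (vonMangoldt B d * (b < d)%N%:R).
    rewrite /psi (big_cat_nat (n := b.+1))//= ?ltnS; last by lia.
    rewrite [in RHS](big_cat_nat (n := b.+1))//= ?ltnS; last by lia.
    rewrite addrAC subrr add0r [X in _ = X + _]big_nat [X in _ = X + _]big1 ?add0r.
      by rewrite !big_nat; apply: eq_bigr => d /andP[-> _]; rewrite mulr1.
    by move=> d /andP[_ h]; rewrite ltnNge -ltnS h mulr0.
  rewrite -!sumrB !big_nat; apply: ler_sum => d /andP[d1 dn].
  rewrite -!mulrBr ler_wpM2l ?vonMangoldt_ge0// -addrA -opprD -natrD lerBrDr -natrD ler_nat.
  have [bd|bd] := ltnP b d.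
    rewrite (divn_small bd) (@divn_small a) ?(leq_ltn_trans ab)//= addn0.
    by rewrite divn_gt0// -ltnS.
  by rewrite add0n nab divnD// leq_addr.
have h2 : ln ('C(n, a)%:R : R) <= a%:R * ln 4.
  rewrite mulr_natl -lnXn// -natrX ler_ln ?posrE ?ltr0n ?expn_gt0 ?bin_gt0 ?ler_nat//.
    exact: bin_half_le.
  by rewrite nab leq_addr.
have h3 : psi B b <= b%:R * ln 4 by apply: IH; lia.
by rewrite nab natrD mulrDl -nab; lra.
Qed.


Lemma sum_ln_prime_le n : \sum_(0 <= p < n.+1 | prime p) ln (p%:R : R) <= n%:R * ln 4.
Proof.
apply: le_trans (@psi_le n.+1 n _) => //.
rewrite big_ltn_cond//= /psi big_mkcond /=; apply: ler_sum_nat => d /andP[_ dn].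
by case: ifP => pd; [exact: vonMangoldt_prime|exact: vonMangoldt_ge0].
Qed.

(** The primes up to sqrt N are counted trivially; each larger prime has 2 ln p / ln N >= 1, so
    [sum_ln_prime_le] counts them. *)
Lemma prime_count_le (N : R) n : 1 < N -> n%:R <= N ->
  \sum_(0 <= p < n.+1 | prime p) (1 : R) <= Num.sqrt N + 2 * ln 4 * N / ln N.
Proof.
move=> N1 nN; have N0 : 0 < N by lra.
have lN : 0 < ln N by exact: ln_gt0.
have hp p : prime p -> 1 <= (p%:R <= Num.sqrt N)%R%:R + 2 / ln N * ln (p%:R : R).
  move=> pp; case: (leP p%:R (Num.sqrt N)) => h.
    by rewrite -[leLHS]addr0 lerD// mulr_ge0 ?ln_nat_ge0 ?divr_ge0// ltW//.
  rewrite add0r mulrAC ler_pdivlMr// mul1r.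
  rewrite -{1}(sqr_sqrtr (ltW N0)) lnXn ?sqrtr_gt0// mulr_natl ler_wMn2r//.
  by rewrite ler_ln ?posrE ?sqrtr_gt0 ?ltr0n ?prime_gt0// ltW.
apply: le_trans (_ : \sum_(0 <= p < n.+1 | prime p) ((p%:R <= Num.sqrt N)%R%:R + 2 / ln N * ln (p%:R : R)) <= _).
  by apply: ler_sum => p /hp.
rewrite big_split /= lerD//; last first.
  rewrite -mulr_sumr mulrAC ler_pM2r ?invr_gt0// -mulrA ler_pM2l//.
  apply: le_trans (sum_ln_prime_le n) _.
  by rewrite mulrC ler_wpM2l// ln_ge0//; lra.
have [k kE kk] : exists2 k : nat, k%:R <= Num.sqrt N & forall p : nat, p%:R <= Num.sqrt N -> (p <= k)%N.
  exists (Num.truncn (Num.sqrt N)); first by rewrite truncn_le// sqrtr_ge0.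
  by move=> p; rewrite truncn_ge_nat// sqrtr_ge0.
apply: le_trans kE; rewrite -natr_sum ler_nat.
apply: leq_trans (_ : \sum_(0 <= p < n.+1 | prime p) (0 < p <= k)%N <= _)%N.
  apply: leq_sum => p pp; rewrite prime_gt0//=.
  by case: (leP p%:R) => // /kk ->.
apply: leq_trans (_ : \sum_(0 <= p < n.+1) (0 < p <= k)%N <= _)%N.
  by rewrite [leqLHS]big_mkcond; apply: leq_sum => p _; case: ifP.
elim: n {nN} => [|n IH]; first by rewrite big_nat1.
rewrite big_nat_recr//=.
have : (\sum_(0 <= p < n.+1) (0 < p <= k) <= n)%N.
  elim: n {IH} => [|n IH]; first by rewrite big_nat1.
  by rewrite big_nat_recr//=; case: (n < k)%N; lia.
by case: leqP; lia.
Qed.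

(** * Mertens' theorem *)

Lemma sum_vonMangoldt_div_ge B n : (0 < n < B)%N ->
  ln n%:R - 1 <= \sum_(1 <= d < n.+1) vonMangoldt B d / d%:R.
Proof.
move=> /andP[n0 nB]; have n0' : 0 < n%:R :> R by rewrite ltr0n.
rewrite -(ler_pM2l n0'); apply: le_trans (_ : ln (n`!%:R : R) <= _).
  by apply: le_trans (ln_fact_ge n); rewrite mulrBr mulr1.
rewrite (@ln_fact_vonMangoldt B)// mulr_sumr; apply: ler_sum_nat => d /andP[d0 _].
rewrite mulrCA ler_wpM2l ?vonMangoldt_ge0// ler_pdivlMr ?ltr0n// -natrM ler_nat.
exact: leq_trunc_div.
Qed.

(** Dropping the integer parts of the n / d costs at most [psi B n], the source of ln 4; the other
    terms are those of Stirling's bound [ln_fact_le]. *)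
Lemma sum_vonMangoldt_div_le B n : (0 < n < B)%N ->
  \sum_(1 <= d < n.+1) vonMangoldt B d / d%:R <= ln n%:R - 1 + ln 4 + (1 + ln n%:R) / n%:R.
Proof.
move=> /andP[n0 nB]; have n0' : 0 < n%:R :> R by rewrite ltr0n.
rewrite -(ler_pM2l n0').
have -> : n%:R * (ln n%:R - 1 + ln 4 + (1 + ln n%:R) / n%:R) =
   (n%:R * ln n%:R - n%:R + 1 + ln n%:R) + n%:R * ln 4 :> R by field; apply: lt0r_neq0.
apply: le_trans (lerD (ln_fact_le _ n0) (psi_le _ _ nB)).
rewrite (@ln_fact_vonMangoldt B)// mulr_sumr -big_split; apply: ler_sum_nat => d /andP[d0 _] /=.
rewrite mulrCA -[X in _ + X]mulr1 -mulrDr ler_wpM2l ?vonMangoldt_ge0//.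
rewrite ler_pdivrMr ?ltr0n// natr1 -natrM ler_nat.
by rewrite ltnW// -ltn_divLR.
Qed.

Lemma abel_sum_div_ln (a : nat -> R) (al be : R) (m y : nat) : (2 <= m)%N -> (m <= y)%N ->
  ln m%:R + be <= \sum_(1 <= d < m.+1) a d ->
  (forall n, (m <= n <= y)%N -> \sum_(1 <= d < n.+1) a d <= ln n%:R + al) ->
  \sum_(m.+1 <= d < y.+1) a d / ln d%:R <=
    ln (ln y%:R) - ln (ln m%:R) + (al - be) / ln m%:R.
Proof.
move=> m2 my lo up.
have ln0 n : (m <= n)%N -> 0 < ln (n%:R : R) by move=> h; apply: ln_gt0; rewrite ltr1n; lia.
(* The added quotient is the boundary term of Abel summation. It makes the induction on [y] go
   through, is nonnegative by [up], and at y = m is bounded by [lo]. *)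
suff : \sum_(m.+1 <= d < y.+1) a d / ln d%:R
   + (ln y%:R + al - \sum_(1 <= d < y.+1) a d) / ln y%:R <=
    ln (ln y%:R) - ln (ln m%:R) + (al - be) / ln m%:R.
  move=> h; apply: le_trans h; rewrite lerDl divr_ge0 ?(ltW (ln0 _ _))// subr_ge0.
  by apply: up; rewrite my leqnn.
elim: y my up => [|y IH] my up; first by lia.
have [ym|ym] := eqVneq m y.+1.
  rewrite -ym subrr big_geq// !add0r.
  rewrite ler_pM2r ?invr_gt0 ?ln0//; lra.
have my' : (m <= y)%N by lia.
rewrite (big_nat_recr y.+1)//= [X in _ + al - X](big_nat_recr y.+1)//=.
set S := \sum_(m.+1 <= d < y.+1) _ in IH *; set T := \sum_(1 <= d < y.+1) _ in IH *.
have hT : 0 <= ln y%:R + al - T.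
  by rewrite subr_ge0; apply: up; rewrite my' /=.
have {IH}: S + (ln y%:R + al - T) / ln y%:R <= ln (ln y%:R) - ln (ln m%:R) + (al - be) / ln m%:R.
  by apply: IH => // n /andP[mn ny]; apply: up; rewrite mn ltnW.
set E := _ + al - T in hT *; move=> IH.
have hl := ln0 _ my; have hl' := ln0 _ my'.
have l1 : E / ln y.+1%:R <= E / ln y%:R.
  rewrite ler_wpM2l// lef_pV2 ?posrE// ler_ln ?posrE ?ltr0n ?ler_nat//; lia.
have l2 : (ln y.+1%:R - ln y%:R) / ln y.+1%:R <= ln (ln y.+1%:R) - ln (ln y%:R) :> R.
  have := le_ln_Bln _ _ hl hl'; rewrite -opprB lerNl => /(le_trans _); apply.
  by rewrite -mulNr opprB.
have -> : S + a y.+1 / ln y.+1%:R + (ln y.+1%:R + al - (T + a y.+1)) / ln y.+1%:R =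
  S + (E / ln y.+1%:R + (ln y.+1%:R - ln y%:R) / ln y.+1%:R).
  by rewrite /E; field; apply: lt0r_neq0.
lra.
Qed.

Lemma sum_prime_inv_le m y : (2 <= m)%N -> (m <= y)%N ->
  \sum_(m.+1 <= p < y.+1 | prime p) (p%:R^-1 : R) <=
    ln (ln y%:R) - ln (ln m%:R) + (ln 4 + (1 + ln m%:R) / m%:R) / ln m%:R.
Proof.
move=> m2 my; set B := y.+1.
have h := @abel_sum_div_ln (fun d => vonMangoldt B d / d%:R)
   (-1 + ln 4 + (1 + ln m%:R) / m%:R) (-1) m y m2 my.
rewrite (_ : ln 4 + _ = (-1 + ln 4 + (1 + ln m%:R) / m%:R) - -1 :> R); last by ring.
apply: le_trans (h _ _).
- rewrite big_mkcond /=; apply: ler_sum_nat => p /andP[mp py].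
  have p0 : 0 < p%:R :> R by rewrite ltr0n; lia.
  have lp : 0 < ln p%:R :> R by apply: ln_gt0; rewrite ltr1n; lia.
  case: ifP => pp; last by rewrite !divr_ge0 ?vonMangoldt_ge0 ?ltW.
  rewrite ler_pdivlMr// mulrC ler_pM2r ?invr_gt0//; exact: vonMangoldt_prime.
- by apply: sum_vonMangoldt_div_ge; rewrite /B; lia.
move=> n /andP[mn ny]; apply: le_trans (@sum_vonMangoldt_div_le B n _) _; first by rewrite /B; lia.
have m0 : 0 < m%:R :> R by rewrite ltr0n; lia.
have n0 : 0 < n%:R :> R by rewrite ltr0n; lia.
(* (1 + ln t) / t decreases for t >= 1, so its value at [m] serves on the whole range. *)
suff : (1 + ln n%:R) / n%:R <= (1 + ln m%:R) / m%:R :> R by lra.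
rewrite ler_pdivrMr// mulrAC ler_pdivlMr//.
have := le_ln_Bln _ _ m0 n0; rewrite ler_pdivlMr//.
have : m%:R * ln m%:R <= n%:R * ln m%:R :> R.
  by rewrite ler_wpM2r ?ler_nat// ln_nat_ge0.
move: (ln _) (ln _) => a b; lra.
Qed.

(** One statement for two Euler products: j = 1 is p / (p - 1), and j = 2 is the factor in the
    coefficient norm of the weights. The part with [j] telescopes over all integers, since 1 / (p (p
    - 1)) = 1 / (p - 1) - 1 / p. *)
Lemma prod_prime_le (j : R) (F : nat -> R) m y : (2 <= m)%N -> (m <= y)%N -> 0 <= j ->
  (forall p, (m < p)%N -> prime p -> 0 <= F p <= 1 + (p%:R^-1 + j / (p%:R * (p%:R - 1)))) ->
  \prod_(m.+1 <= p < y.+1 | prime p) F p <=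
    ln y%:R / ln m%:R * expR ((ln 4 + (1 + ln m%:R) / m%:R) / ln m%:R + j / m%:R).
Proof.
move=> m2 my j0 hF.
have ln0 n : (m <= n)%N -> 0 < ln (n%:R : R) by move=> h; apply: ln_gt0; rewrite ltr1n; lia.
have m0 : 0 < m%:R :> R by rewrite ltr0n; lia.
apply: le_trans (_ : expR (\sum_(m.+1 <= p < y.+1 | prime p) (p%:R^-1 : R) + j / m%:R) <= _); last first.
  rewrite -{1}(lnK (_ : ln y%:R / ln m%:R \in Num.pos)) ?posrE ?divr_gt0 ?ln0// -expRD.
  rewrite ler_expR ln_div ?posrE ?ln0// addrA lerD2r; exact: sum_prime_inv_le.
apply: le_trans (_ : expR (\sum_(m.+1 <= p < y.+1 | prime p) (p%:R^-1 + j / (p%:R * (p%:R - 1)))) <= _).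
  rewrite expR_sum big_nat_cond [leRHS]big_nat_cond; apply: ler_prod => p /andP[/andP[mp _] pp].
  have /andP[-> h] := hF p mp pp; apply: le_trans h (expR_ge1Dx _).
rewrite ler_expR big_split lerD2l /=.
apply: le_trans (_ : \sum_(m.+1 <= p < y.+1) j * ((p.-1)%:R^-1 - p%:R^-1) <= _).
  rewrite big_mkcond /=; apply: ler_sum_nat => p /andP[mp _].
  have p1 : 0 < p%:R - 1 :> R by rewrite subr_gt0 ltr1n; lia.
  have p0 : 0 < p%:R :> R by lra.
  have -> : p.-1%:R = p%:R - 1 :> R by rewrite -subn1 natrB//; lia.
  have E : j / (p%:R * (p%:R - 1)) = j * ((p%:R - 1)^-1 - p%:R^-1).
    by field; rewrite !lt0r_neq0.
  by case: ifP => _; rewrite -E// divr_ge0//; apply: mulr_ge0; exact: ltW.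
rewrite -mulr_sumr ler_wpM2l//.
suff -> : \sum_(m.+1 <= p < y.+1) (p.-1%:R^-1 - p%:R^-1) = m%:R^-1 - y%:R^-1 :> R.
  by rewrite gerDl oppr_le0 invr_ge0.
elim: y my => [|y IH] my; first by lia.
have [->|ym] := eqVneq m y.+1; first by rewrite big_geq ?subrr.
by rewrite big_nat_recr ?IH /=; [ring|lia..].
Qed.

(** Computed outright, because the explicit error in Mertens' theorem is too large for small primes;
    the asymptotic value e^gamma ln 256 is about 9.88. *)
Lemma prod_prime_sub1_256 :
  \prod_(0 <= p < 257 | prime p) (p%:R / (p%:R - 1)) <= (997 / 100 : R).
Proof.
rewrite (eq_bigr (fun p => p%:R / p.-1%:R)); last first.
  by move=> p pp; rewrite -subn1 natrB// prime_gt0.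
rewrite -big_filter [X in \prod_(_ <- X) _](_ : _ =
 [:: 2; 3; 5; 7; 11; 13; 17; 19; 23; 29; 31; 37; 41; 43; 47; 53; 59; 61; 67; 71; 73; 79;
     83; 89; 97; 101; 103; 107; 109; 113; 127; 131; 137; 139; 149; 151; 157; 163; 167;
     173; 179; 181; 191; 193; 197; 199; 211; 223; 227; 229; 233; 239; 241; 251]%N)//.
by rewrite !big_cons big_nil /=; lra.
Qed.

End Chebyshev.

(** * Trigonometric sums *)

Section Trigonometry.
Context {R : realType}.
Implicit Types (x t : R) (z : R[i]).
Local Notation nc := (@Normc.normc R).

Lemma sin_le_id x : 0 <= x -> sin x <= x.
Proof.
move=> x0; rewrite -subr_ge0.
have dr t : is_derive t 1 (fun y : R => y - sin y) (1 - cos t).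
  by apply: is_deriveB.
have := @ger0_derive1_ndecry R (fun y : R => y - sin y) 0 _ _ _ 0 x (lexx 0) x0.
rewrite sin0 subr0; apply.
- by move=> t _; exact: (@ex_derive _ _ _ _ _ _ _ (dr t)).
- by move=> t _; rewrite derive1E (@derive_val _ _ _ _ _ _ _ (dr t)) subr_ge0 cos_le1.
- apply: derivable_within_continuous => t _; exact: (@ex_derive _ _ _ _ _ _ _ (dr t)).
Qed.

Lemma mulr_cos_le_sin x : 0 <= x <= pi / 2 -> x * cos x <= sin x.
Proof.
move=> /andP[x0 xp]; rewrite -subr_ge0.
have dr t : is_derive t 1 (fun y : R => sin y - y * cos y) (t * sin t).
  have -> : t * sin t = cos t - (t *: (- sin t) + cos t *: 1).
    by rewrite /GRing.scale /=; ring.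
  by apply: is_deriveB.
have := @ger0_derive1_ndecr R (fun y : R => sin y - y * cos y) 0 (pi / 2) _ _ _ 0 x (lexx 0) x0 xp.
rewrite sin0 mul0r subr0; apply.
- by move=> t _; exact: (@ex_derive _ _ _ _ _ _ _ (dr t)).
- move=> t; rewrite in_itv /= => /andP[t0 tp]; rewrite derive1E (@derive_val _ _ _ _ _ _ _ (dr t)).
  rewrite mulr_ge0 ?(ltW t0)// sin_ge0_pi// (ltW t0) /=; have := pi_gt0 R; lra.
- apply: derivable_within_continuous => t _; exact: (@ex_derive _ _ _ _ _ _ _ (dr t)).
Qed.

(** The triple angle formula at pi / 6 forces sin (pi / 6) = 1 / 2, and sin x <= x does the rest. *)
Lemma pi_ge3 : 3 <= pi :> R.
Proof.
have p0 := pi_gt0 R.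
set s := sin (pi / 6 : R); set c := cos (pi / 6 : R).
have cs : c ^+ 2 = 1 - s ^+ 2 by rewrite -(cos2Dsin2 (pi / 6)) addrK.
have E : sin (pi / 2 : R) = 3 * s - 4 * s ^+ 3.
  have -> : pi / 2 = pi / 6 + pi / 6 + pi / 6 :> R by lra.
  rewrite !sinD cosD -/s -/c.
  transitivity (3 * s * c ^+ 2 - s ^+ 3); first by ring.
  by rewrite cs; ring.
rewrite sin_pihalf in E.
have s0 : 0 < s by apply: sin_gt0_pi; lra.
have : (s + 1) * (2 * s - 1) ^+ 2 = 0.
  by transitivity (1 - (3 * s - 4 * s ^+ 3)); [ring | rewrite -E subrr].
move/eqP; rewrite mulf_eq0 sqrf_eq0 => /orP[/eqP|/eqP]; first by lra.
have := sin_le_id (pi / 6); rewrite -/s; lra.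
Qed.

Lemma sin_sqr_le t : sin t ^+ 2 <= t ^+ 2.
Proof.
rewrite -[leLHS]real_normK ?num_real// -[leRHS]real_normK ?num_real//.
rewrite lerXn2r ?nnegrE//.
wlog t0 : t / 0 <= t.
  by case: (leP 0 t) => h; [exact|rewrite -normrN -sinN -[leRHS]normrN; apply; lra].
rewrite (ger0_norm t0).
have [t1|t1] := leP 1 t; first by apply: le_trans (sin_max t) t1.
by rewrite ger0_norm ?sin_le_id// sin_ge0_pi//; have := pi_ge3; lra.
Qed.

(** The square of t <= tan t. Its use is in the form 1 / sin^2 t <= 1 + 1 / t^2. *)
Lemma sin_sqr_ge t : `|t| <= pi / 2 -> t ^+ 2 <= (1 + t ^+ 2) * sin t ^+ 2.
Proof.
wlog t0 : t / 0 <= t.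
  move=> h; case: (leP 0 t) => t0; first exact: h.
  by move: (h (- t)); rewrite normrN sinN !sqrrN; apply; lra.
rewrite (ger0_norm t0) => tp.
have : (t * cos t) ^+ 2 <= sin t ^+ 2.
  rewrite lerXn2r ?nnegrE ?mulr_cos_le_sin ?t0//.
    by rewrite mulr_ge0// cos_ge0_pihalf//; lra.
  by rewrite sin_ge0_pi// t0; lra.
rewrite exprMn -[cos t ^+ 2](addrK (sin t ^+ 2)) cos2Dsin2; lra.
Qed.

Lemma normc_ge0 z : 0 <= nc z.
Proof. by case: z => a b; exact: sqrtr_ge0. Qed.

Lemma normc_sqr z : nc z ^+ 2 = complex.Re z ^+ 2 + complex.Im z ^+ 2.
Proof. by case: z => a b /=; rewrite sqr_sqrtr// addr_ge0 ?sqr_ge0. Qed.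

Lemma normcD (z w : R[i]) : nc (z + w) <= nc z + nc w.
Proof. exact: le_normcD. Qed.

Lemma normc_opp z : nc (- z) = nc z.
Proof. exact: normcN. Qed.

Lemma normcB (z w : R[i]) : nc (z - w) <= nc z + nc w.
Proof. by rewrite -(normc_opp w) normcD. Qed.

Lemma normc_sum (I : Type) (r : seq I) (P : pred I) (F : I -> R[i]) :
  nc (\sum_(i <- r | P i) F i) <= \sum_(i <- r | P i) nc (F i).
Proof.
elim/big_rec2: _ => [|i a z _ h]; first by rewrite Normc.normc0.
by apply: le_trans (normcD _ _) _; rewrite lerD2l.
Qed.

Lemma normc_real (r : R) : nc r%:C%C = `|r|.
Proof. by rewrite /= expr0n addr0 sqrtr_sqr. Qed.

Lemma normc_nat n : nc n%:R = n%:R.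
Proof. by rewrite -(rmorph_nat (real_complex R)) normc_real ger0_norm. Qed.

Lemma normc_conj z : nc z^*%C = nc z.
Proof. by case: z => a b /=; rewrite sqrrN. Qed.

Lemma normc_sqrC z : (nc z ^+ 2)%:C%C = z * z^*%C.
Proof.
case: z => a b; rewrite normc_sqr /=; apply/eqP; rewrite eq_complex /=.
by apply/andP; split; apply/eqP; ring.
Qed.

Lemma normc_expi t : nc (expi t) = 1.
Proof. by rewrite /= cos2Dsin2 sqrtr1. Qed.

Lemma expi0 : expi 0 = 1 :> R[i].
Proof. by rewrite -(mulr0n 1) expi_nat. Qed.

Lemma expi_conj t : (expi t)^*%C = expi (- t).
Proof. by rewrite /expi mulrN cosN sinN. Qed.

Lemma normc_1Bexpi t : nc (1 - expi t) ^+ 2 = 4 * sin (pi * t) ^+ 2.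
Proof.
have -> : expi t = expi (t / 2 + t / 2) by rewrite -splitr.
rewrite normc_sqr /expi /= add0r (_ : 2 * pi * (t / 2 + t / 2) = pi * t + pi * t); last by field.
rewrite cosD sinD; move: (cos2Dsin2 (pi * t)).
move: (cos _) (sin _) => c s h.
have c2 : c ^+ 2 = 1 - s ^+ 2 by rewrite -h addrK.
transitivity ((1 - c ^+ 2 + s ^+ 2) ^+ 2 + 4 * s ^+ 2 * c ^+ 2); first by ring.
by rewrite c2; ring.
Qed.

Lemma normc_1Bexpi_le t : nc (1 - expi t) <= 2 * pi * `|t|.
Proof.
have p0 := pi_gt0 R.
rewrite -(@ler_pXn2r _ 2)// ?nnegrE ?normc_ge0 ?mulr_ge0// ?(ltW p0)//.
rewrite normc_1Bexpi exprMn real_normK ?num_real// exprMn.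
have := sin_sqr_le (pi * t); rewrite exprMn; lra.
Qed.

Definition geom (n : nat) t : R[i] := \sum_(0 <= k < n) expi (t * k%:R).

Lemma normc_geom_le n t : nc (geom n t) <= n%:R.
Proof.
apply: le_trans (normc_sum _ _ _ _) _.
by under eq_bigr do rewrite normc_expi; rewrite sumr_const_nat subn0.
Qed.

Lemma geom_mul n t : (1 - expi t) * geom n t = 1 - expi (t * n%:R).
Proof.
rewrite /geom; elim: n => [|n IH]; first by rewrite big_geq// mulr0 mulr0 expi0 subrr.
rewrite big_nat_recr//= mulrDr IH mulrBl mul1r -expiD -natr1 mulrDr mulr1 addrC [t * _ + t]addrC.
ring.
Qed.

Lemma normc_geom_sin n t : nc (geom n t) ^+ 2 * sin (pi * t) ^+ 2 <= 1.
Proof.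
have h : nc (1 - expi t) ^+ 2 * nc (geom n t) ^+ 2 <= 2 ^+ 2.
  rewrite -exprMn -Normc.normcM geom_mul lerXn2r ?nnegrE ?normc_ge0//.
  by apply: le_trans (normcB _ _) _; rewrite Normc.normc1 normc_expi; lra.
move: h; rewrite normc_1Bexpi; lra.
Qed.

(* The constant is crude: one has [nc (geom n t) <= 1 / (2 |d|)]. *)
Lemma normc_geom_dist n t (k : int) : `|t - k%:~R| <= 1 / 2 ->
  nc (geom n t) * `|t - k%:~R| <= 2 / 3.
Proof.
set d := t - k%:~R => d2.
have p0 := pi_gt0 R; have p3 := pi_ge3; have p4 := pihalf_lt2 R.
have -> : geom n t = geom n d.
  rewrite /geom; apply: eq_bigr => i _; rewrite /d mulrBl.
  have -> : expi (t * i%:R - k%:~R * i%:R) = expi (t * i%:R) * expi ((- k * i%:Z)%:~R).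
    by rewrite -expiD; congr expi; rewrite intrM mulrNz mulNr.
  by rewrite expi_int mulr1.
have := normc_geom_sin n d; set g := nc _; set s := sin _ => gs.
have g0 : 0 <= g by exact: normc_ge0.
have := sin_sqr_ge (pi * d); rewrite normrM (gtr0_norm p0) -/s.
move=> /(_ _)/[!exprMn] hs.
have {}hs : pi ^+ 2 * d ^+ 2 <= (1 + pi ^+ 2 * d ^+ 2) * s ^+ 2.
  by apply: hs; rewrite ler_pM2l//; lra.
have dd : d ^+ 2 <= 1 / 4.
  rewrite -real_normK ?num_real//; have -> : 1 / 4 = (1 / 2) ^+ 2 :> R by field.
  by rewrite lerXn2r ?nnegrE//; lra.
have pp : 9 <= pi ^+ 2 :> R by nra.
have h1 : g ^+ 2 * (pi ^+ 2 * d ^+ 2) <= (1 + pi ^+ 2 * d ^+ 2) * (g ^+ 2 * s ^+ 2).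
  by rewrite [leRHS]mulrCA ler_wpM2l// sqr_ge0.
have h2 : (1 + pi ^+ 2 * d ^+ 2) * (g ^+ 2 * s ^+ 2) <= 1 + pi ^+ 2 * d ^+ 2.
  by rewrite ler_piMr// addr_ge0// mulr_ge0// sqr_ge0.
have h3 : pi ^+ 2 * d ^+ 2 <= pi ^+ 2 * (1 / 4) by rewrite ler_wpM2l// sqr_ge0.
have h4 : pi ^+ 2 * (g ^+ 2 * d ^+ 2) <= pi ^+ 2 * (4 / 9) by lra.
have := h4; rewrite ler_pM2l ?exprn_gt0// => h5.
rewrite -(@ler_pXn2r _ 2)// ?nnegrE ?mulr_ge0//.
rewrite exprMn real_normK ?num_real//; lra.
Qed.

End Trigonometry.

(** * The large sieve *)

Section LargeSieve.
Context {R : realType}.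
Local Notation nc := (@Normc.normc R).

Definition expsum {n} (u : 'I_n -> R[i]) (x : 'I_n -> R) (t : R) : R[i] :=
  \sum_i u i * expi (x i * t).

(** Distance modulo 1 on real representatives: bounding all integer translates avoids both the
    quotient and the infimum. *)
Definition spaced {n} (delta : R) (x : 'I_n -> R) :=
  forall i j, i != j -> forall k : int, delta <= `|x i - x j - k%:~R|.

(** Open the squares and take absolute values pair by pair. The weights [c] may change sign, as h^2
    - G does later. *)
Lemma quadratic_form_le (n : nat) (u : 'I_n -> R[i]) (x : 'I_n -> R)
    (I : Type) (r : seq I) (c t : I -> R) :
  \sum_(k <- r) c k * nc (expsum u x (t k)) ^+ 2 <=
  \sum_i \sum_j nc (u i) * nc (u j) * nc (\sum_(k <- r) (c k)%:C%C * expi ((x i - x j) * t k)).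
Proof.
set T := \sum_(k <- r) _.
have E : T%:C%C = \sum_i \sum_j u i * (u j)^*%C * \sum_(k <- r) (c k)%:C%C * expi ((x i - x j) * t k).
  rewrite /T rmorph_sum /=.
  under [RHS]eq_bigr => i _.
    under eq_bigr => j _ do rewrite mulr_sumr.
    rewrite exchange_big /=; over.
  rewrite exchange_big /=; apply: eq_bigr => k _.
  rewrite rmorphM /= normc_sqrC /expsum rmorph_sum /= mulr_suml mulr_sumr.
  apply: eq_bigr => i _; rewrite mulr_sumr mulr_sumr; apply: eq_bigr => j _.
  have -> : conjc (u j * expi (x j * t k)) = (u j)^*%C * (expi (x j * t k))^*%C by exact: rmorphM.
  by rewrite expi_conj mulrBl expiD; ring.
apply: le_trans (ler_norm T) _; rewrite -normc_real E.
apply: le_trans (normc_sum _ _ _ _) _; apply: ler_sum => i _.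
apply: le_trans (normc_sum _ _ _ _) _; apply: ler_sum => j _.
by rewrite !Normc.normcM normc_conj.
Qed.

Lemma schur_test (n : nat) (w : 'I_n -> R) (K : 'I_n -> 'I_n -> R) (Q : R) :
  (forall i j, 0 <= K i j) -> (forall i j, K i j = K j i) ->
  (forall i, \sum_(j | j != i) K i j <= Q) ->
  \sum_i \sum_(j | j != i) w i * w j * K i j <= Q * \sum_i w i ^+ 2.
Proof.
move=> K0 Ks KQ.
apply: le_trans (_ : \sum_i \sum_(j | j != i) (w i ^+ 2 * K i j / 2 + w j ^+ 2 * K i j / 2) <= _).
  apply: ler_sum => i _; apply: ler_sum => j _; have := K0 i j => k0.
  have : 0 <= (w i - w j) ^+ 2 * K i j by rewrite mulr_ge0// sqr_ge0.
  by rewrite sqrrB; lra.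
under eq_bigr do rewrite big_split /=.
rewrite big_split /=.
have e : \sum_i \sum_(j | j != i) w j ^+ 2 * K i j / 2 = \sum_i \sum_(j | j != i) w i ^+ 2 * K i j / 2.
  under eq_bigr do rewrite big_mkcond /=.
  rewrite exchange_big /=; apply: eq_bigr => i _; rewrite [RHS]big_mkcond /=.
  by apply: eq_bigr => j _; rewrite eq_sym Ks.
rewrite e -big_split mulr_sumr; apply: ler_sum => i _ /=.
rewrite -mulr_suml -mulr_sumr -splitr mulrC ler_wpM2r ?sqr_ge0//; exact: KQ.
Qed.

(** From k = 3 on, k^-2 is at most 1 / (k - 1/2) - 1 / (k + 1/2), which telescopes to 2/5; and 1 +
    1/4 + 2/5 = 33/20. *)
Lemma sum_inv_sqr_le m : \sum_(1 <= k < m.+1) (k%:R ^- 2 : R) <= 33 / 20.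
Proof.
suff h n : \sum_(1 <= k < n.+3) (k%:R ^- 2 : R) <= 33 / 20 - (n%:R + 5 / 2)^-1.
  case: m => [|[|m]]; [by rewrite big_geq//; lra|by rewrite big_nat1; lra|].
  apply: le_trans (h m) _; rewrite gerDl oppr_le0 invr_ge0; have := ler0n R m; lra.
elim: n => [|n IH]; first by rewrite big_nat_recr//= big_nat1 add0r invf_div; lra.
rewrite big_nat_recr//=; have n0 := ler0n R n.
have -> : n.+3%:R = n%:R + 3 :> R by rewrite -natrD addn3.
have -> : n.+1%:R = n%:R + 1 :> R by rewrite -natr1.
suff : (n%:R + 3) ^- 2 <= (n%:R + 5 / 2)^-1 - (n%:R + 1 + 5 / 2)^-1 :> R by lra.
have -> : (n%:R + 5 / 2)^-1 - (n%:R + 1 + 5 / 2)^-1 = ((n%:R + 3) ^+ 2 - 1 / 4)^-1 :> R.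
  field; apply/and3P; split; apply: lt0r_neq0; nra.
rewrite lef_pV2 ?posrE; nra.
Qed.

(* Two points on the same side of [x i] whose distances to it have the same
   integral part in units of [delta] coincide. *)
Lemma sum_inv_sin_sqr_le n (delta : R) (x : 'I_n -> R) (i : 'I_n) :
  0 < delta -> spaced delta x ->
  \sum_(j | j != i) (sin (pi * (x i - x j)) ^+ 2)^-1 <=
    delta^-1 + 11 / 30 * delta ^- 2.
Proof.
move=> d0 sep.
pose rd j : int := Num.floor (x i - x j + 1 / 2).
pose d j := x i - x j - (rd j)%:~R.
have dle j : `|d j| <= 1 / 2.
  have := floor_itv (x i - x j + 1 / 2); rewrite -/(rd j) intrD => /andP[h1 h2].
  by rewrite /d ler_norml; lra.
have dge j : j != i -> delta <= `|d j| by rewrite eq_sym => ji; exact: sep.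
pose m := Num.truncn (1 / (2 * delta)).
pose key j : bool * 'I_m.+1 := (0 <= d j, inord (Num.truncn (`|d j| / delta))).
have keyE j : nat_of_ord (key j).2 = Num.truncn (`|d j| / delta).
  rewrite /= inordK// ltnS /m; apply: le_truncn.
  rewrite ler_pdivrMr// [leRHS](_ : _ = 1 / 2) ?dle//.
  by field; apply: lt0r_neq0.
have keylt j : (key j).2%:R * delta <= `|d j| < ((key j).2%:R + 1) * delta.
  rewrite keyE; have := truncn_itv (_ : 0 <= `|d j| / delta).
  rewrite divr_ge0 ?(ltW d0)// => /(_ isT)/andP[h1 h2].
  by rewrite -ler_pdivlMr// h1 -ltr_pdivrMr// natr1.
have key1 j : j != i -> (0 < (key j).2)%N.
  move=> ji; rewrite keyE truncn_gt0 ler_pdivlMr// mul1r; exact: dge.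
have inj : {in [set j | j != i] &, injective key}.
  move=> j k _ _ e; apply/eqP; apply: contraT => jk.
  have hjk : delta <= `|d j - d k|.
    have := sep _ _ jk (rd k - rd j); rewrite /d -normrN.
    by congr (_ <= `|_|); rewrite intrB; ring.
  suff : `|d j - d k| < delta by rewrite ltNge hjk.
  have sg : (0 <= d j) = (0 <= d k) by case: e.
  have := keylt j; have := keylt k; rewrite -e mulrDl mul1r.
  move: (_ * delta) => a.
  case: (leP 0 (d j)) sg => h1 h2; [move/esym in h2|move/esym/negbT in h2].
    by rewrite (ger0_norm h1) (ger0_norm h2) ltr_norml; lra.
  by rewrite -ltNge in h2; rewrite (ltr0_norm h1) (ltr0_norm h2) ltr_norml; lra.
(* This bounds 1 / sin^2 at a distance at least k delta, by [sin_sqr_ge] and pi >= 3. Each k serves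
   at most two points, one on each side, whence 2 * 33 / 180 = 11 / 30. *)
pose G (k : nat) : R := 1 + (9 * k%:R ^+ 2 * delta ^+ 2)^-1.
have G0 k : 0 <= G k by rewrite addr_ge0 ?invr_ge0 ?mulr_ge0 ?exprn_ge0 ?(ltW d0).
have p0 := pi_gt0 R; have p3 := @pi_ge3 R.
have le1 j : j != i -> (sin (pi * (x i - x j)) ^+ 2)^-1 <= G (key j).2.
  move=> ji; have k0 := key1 j ji; have /andP[kd _] := keylt j.
  have -> : sin (pi * (x i - x j)) ^+ 2 = sin (pi * d j) ^+ 2.
    apply: (@mulfI _ 4); first by rewrite pnatr_eq0.
    rewrite -!normc_1Bexpi; congr (nc (1 - _) ^+ 2).
    by rewrite -[LHS]mulr1 -(expi_int (- rd j)) -expiD mulrNz.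
  have := sin_sqr_ge (pi * d j); rewrite normrM (gtr0_norm p0) ler_pM2l// -[2^-1]mul1r dle => /(_ isT).
  have dj0 : 0 < `|d j| by apply: lt_le_trans d0 (dge j ji).
  have pd0 : 0 < (pi * d j) ^+ 2 by rewrite exprn_even_gt0//= mulf_neq0 ?(lt0r_neq0 p0)// -normr_gt0.
  move=> h; have s0 : 0 < sin (pi * d j) ^+ 2.
    rewrite lt0r sqr_ge0 andbT; apply/negP => /eqP s0; move: h; rewrite s0; lra.
  have h2 : (sin (pi * d j) ^+ 2)^-1 <= 1 + ((pi * d j) ^+ 2)^-1.
    rewrite -[leLHS]mul1r ler_pdivrMr//; move: h pd0; move: ((pi * d j) ^+ 2) => P h P0.
    have -> : 1 + P^-1 = (1 + P) / P by field; apply: lt0r_neq0.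
    by rewrite mulrAC ler_pdivlMr// mul1r.
  apply: le_trans h2 _; rewrite lerD2l.
  have k0' : 0 < (key j).2%:R :> R by rewrite ltr0n.
  rewrite lef_pV2 ?posrE// ?(mulr_gt0 (mulr_gt0 _ (exprn_gt0 _ _)) (exprn_gt0 _ _))//.
  have hk : ((key j).2%:R * delta) ^+ 2 <= d j ^+ 2.
    rewrite -[leRHS]real_normK ?num_real// lerXn2r ?nnegrE//.
    by rewrite mulr_ge0// ltW.
  have p9 : 9 <= pi ^+ 2 :> R by nra.
  rewrite -mulrA -exprMn [leRHS]exprMn; apply: ler_pM => //; exact: sqr_ge0.
apply: le_trans (_ : \sum_(j in [set j | j != i]) G (key j).2 <= _).
  rewrite [leRHS](eq_bigl (fun j => j != i)); last by move=> j; rewrite inE.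
  exact: ler_sum.
rewrite -(big_imset (fun w : bool * 'I_m.+1 => G w.2) inj) /=.
apply: le_trans (_ : \sum_(w : bool * 'I_m.+1 | (0 < w.2)%N) G w.2 <= _).
  rewrite big_mkcond [leRHS]big_mkcond; apply: ler_sum => w _.
  case: imsetP => [[j]|_]; last by case: ifP.
  by rewrite inE => ji ->; rewrite key1.
have -> : \sum_(w : bool * 'I_m.+1 | (0 < w.2)%N) G w.2 = 2 * \sum_(1 <= k < m.+1) G k.
  rewrite -(pair_big predT (fun k : 'I_m.+1 => (0 < k)%N) (fun _ k => G k)) /= sumr_const card_bool.
  rewrite -[LHS]mulr_natl; congr (_ * _); rewrite -(big_mkord (fun k => (0 < k)%N) G) big_ltn_cond//=.
  by rewrite big_nat_cond [RHS]big_nat_cond; apply: eq_bigl => k; rewrite andbT; case: k => //= k; rewrite andbT.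
rewrite /G big_split /= sumr_const_nat subn1 /=.
have hm : 2 * m%:R <= delta^-1.
  have : m%:R <= 1 / (2 * delta) by rewrite truncn_le// divr_ge0// mulr_ge0// ltW.
  rewrite ler_pdivlMr ?mulr_gt0// => h.
  by rewrite -[leRHS]mul1r ler_pdivlMr//; lra.
have hs : \sum_(1 <= k < m.+1) (9 * k%:R ^+ 2 * delta ^+ 2)^-1 <= 33 / 180 * delta ^- 2.
  apply: le_trans (_ : (9 * delta ^+ 2)^-1 * \sum_(1 <= k < m.+1) (k%:R ^- 2) <= _).
    rewrite mulr_sumr le_eqVlt; apply/orP; left; apply/eqP; apply: eq_big_nat => k /andP[k0 _].
    by rewrite -invfM; congr _^-1; ring.
  rewrite invfM mulrAC ler_pM2r ?invr_gt0 ?exprn_gt0//.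
  by have := sum_inv_sqr_le m; lra.
lra.
Qed.

Lemma sin_pi_sqr_gt0 (t : R) : (forall k : int, t - k%:~R != 0) -> 0 < sin (pi * t) ^+ 2.
Proof.
move=> tk; have p0 := pi_gt0 R.
have := floor_itv (t + 1 / 2); set k := Num.floor _; rewrite intrD => /andP[k1 k2].
rewrite lt0r sqr_ge0 andbT; apply/negP => /eqP s0.
have : 4 * sin (pi * (t - k%:~R)) ^+ 2 = 4 * sin (pi * t) ^+ 2.
  rewrite -!normc_1Bexpi; congr (nc (1 - _) ^+ 2).
  by rewrite expiD -mulrNz expi_int mulr1.
rewrite s0 mulr0 => /eqP; rewrite mulf_eq0 pnatr_eq0 /= => /eqP s1.
have := sin_sqr_ge (pi * (t - k%:~R)); rewrite s1 mulr0 normrM (gtr0_norm p0) ler_pM2l//.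
have -> : `|t - k%:~R| <= 2^-1 by rewrite ler_norml; lra.
move=> /(_ isT); rewrite leNgt => /negP; apply.
by rewrite exprn_even_gt0//= mulf_neq0 ?(lt0r_neq0 p0).
Qed.

(** The number of ways to write k as a + b - (M - 1) with b < M and a < M0 + M is a trapezoid, equal
    to M on [0, M0]. Its transform is a product of two geometric sums, at most M (M0 + M) on the
    diagonal and 1 / sin^2 off it, so the Schur test loses no logarithm. *)
Lemma large_sieve n (delta : R) (u : 'I_n -> R[i]) (x : 'I_n -> R) (M0 M : nat) :
  0 < delta -> spaced delta x -> (0 < M)%N ->
  \sum_(0 <= k < M0.+1) nc (expsum u x k%:R) ^+ 2 <=
  (M0%:R + M%:R + (delta^-1 + 11 / 30 * delta ^- 2) / M%:R) * \sum_i nc (u i) ^+ 2.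
Proof.
move=> d0 sep M1; have M1' : 0 < M%:R :> R by rewrite ltr0n.
set A := (M0 + M)%N; set s := M.-1; set Q := _ + 11 / 30 * _; set F2 := \sum_i _.
pose r := [seq (b, a) | b <- index_iota 0 M, a <- index_iota 0 A].
pose t (w : nat * nat) : R := w.1%:R + w.2%:R - s%:R.
have lo : M%:R * \sum_(0 <= k < M0.+1) nc (expsum u x k%:R) ^+ 2 <=
    \sum_(w <- r) 1 * nc (expsum u x (t w)) ^+ 2.
  rewrite big_allpairs_dep /= mulr_natl -[M in leLHS]subn0 -sumr_const_nat.
  apply: ler_sum_nat => b /andP[_ bM].
  have bs : (b <= s)%N by rewrite /s; lia.
  rewrite [leRHS](big_cat_nat (n := (s - b)%N))//=; last by rewrite /A /s; lia.
  rewrite [X in _ <= _ + X](big_cat_nat (n := (0 + (s - b) + M0.+1)%N))//=; [|by lia|by rewrite /A /s; lia].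
  rewrite addrCA ler_wpDr//.
    by rewrite addr_ge0// sumr_ge0// => a _; rewrite mul1r sqr_ge0.
  rewrite -{1}[(s - b)%N]add0n big_addn add0n addnC addnK le_eqVlt; apply/orP; left.
  apply/eqP/eq_bigr => k _; rewrite mul1r /t /=; congr (nc (expsum u x _) ^+ 2).
  by rewrite natrD natrB//; ring.
rewrite -(ler_pM2l M1'); apply: le_trans lo _.
apply: le_trans (quadratic_form_le _ _ _ _ _ _ _) _.
pose V i j := nc (\sum_(w <- r) (1 : R)%:C%C * expi ((x i - x j) * t w)).
have VE i j : V i j = nc (geom M (x i - x j)) * nc (geom A (x i - x j)).
  rewrite /V big_allpairs_dep /= -Normc.normcM -[RHS]mul1r -(normc_expi (- ((x i - x j) * s%:R))).
  rewrite -Normc.normcM; congr nc; rewrite /geom mulr_suml mulr_sumr; apply: eq_bigr => b _.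
  rewrite !mulr_sumr; apply: eq_bigr => a _.
  by rewrite normc_expi mul1r -!expiD; congr expi; rewrite /t /=; ring.
have V0 i j : 0 <= V i j by exact: normc_ge0.
have VAM i j : V i j <= M%:R * A%:R.
  by rewrite VE ler_pM ?normc_ge0 ?normc_geom_le.
pose K i j : R := (sin (pi * (x i - x j)) ^+ 2)^-1.
have VK i j : j != i -> V i j <= K i j.
  rewrite eq_sym => ij.
  have s0 : 0 < sin (pi * (x i - x j)) ^+ 2.
    by apply: sin_pi_sqr_gt0 => k; rewrite -normr_gt0 (lt_le_trans d0)// sep.
  rewrite /K -[leRHS]mul1r ler_pdivlMr// VE.
  have := normc_geom_sin M (x i - x j); have := normc_geom_sin A (x i - x j).
  move: (nc _) (nc _) (sin _ ^+ 2) s0 => a b c c0 h1 h2.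
  have : 0 <= (a - b) ^+ 2 * c by rewrite mulr_ge0 ?sqr_ge0// ltW.
  by rewrite sqrrB; lra.
apply: le_trans (_ : \sum_i (nc (u i) ^+ 2 * (M%:R * A%:R) +
     \sum_(j | j != i) nc (u i) * nc (u j) * K i j) <= _).
  apply: ler_sum => i _; rewrite (bigD1 i)//= lerD//.
    by rewrite -expr2 ler_wpM2l ?sqr_ge0//; exact: VAM.
  by apply: ler_sum => j ji; rewrite ler_wpM2l ?mulr_ge0 ?normc_ge0//; exact: VK.
rewrite big_split /= -mulr_suml.
have := @schur_test n (fun i => nc (u i)) K Q _ _ _.
rewrite -/F2 => h; apply: le_trans (lerD (lexx _) (h _ _ _)) _.
- by move=> i j; rewrite /K invr_ge0 sqr_ge0.
- by move=> i j; rewrite /K -opprB mulrN sinN sqrrN.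
- by move=> i; exact: sum_inv_sin_sqr_le.
rewrite /A natrD le_eqVlt; apply/orP; left; apply/eqP.
by field; apply: lt0r_neq0.
Qed.

Lemma large_sieve_uniform n (delta N : R) (u : 'I_n -> R[i]) (x : 'I_n -> R) (M0 : nat) :
  0 < delta -> spaced delta x -> 100 <= N -> M0%:R <= N ->
  \sum_(0 <= k < M0.+1) nc (expsum u x k%:R) ^+ 2 <=
  61 / 50 * (N + delta^-1) * \sum_i nc (u i) ^+ 2.
Proof.
move=> d0 sep N1 MN; have d0' : 0 < delta^-1 by rewrite invr_gt0.
have F0 : 0 <= \sum_i nc (u i) ^+ 2 by rewrite sumr_ge0// => i _; exact: sqr_ge0.
(* M + 11/30 delta^-2 / M is least near M = 0.606 / delta. Taking M just above 3 / (5 delta) gives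
   3/5 + 11/18 < 61/50 in front of 1 / delta, and N >= 100 absorbs the remaining 8/3. *)
have h0 : 0 <= 3 / 5 * delta^-1 by lra.
have /andP[k1 k2] := truncn_itv h0.
apply: le_trans (@large_sieve _ delta u x M0 (Num.truncn (3 / 5 * delta^-1)).+1 d0 sep isT) _.
rewrite ler_wpM2r//.
move: k1 k2; set m := Num.truncn _; rewrite -exprVn.
move: (delta^-1) d0' => D D0; rewrite -[m.+1%:R]natr1; move: (m%:R) => y y1 y2.
have hy : 0 < y + 1 by lra.
suff : (D + 11 / 30 * D ^+ 2) / (y + 1) <= 5 / 3 + 11 / 18 * D by lra.
by rewrite ler_pdivrMr//; nra.
Qed.

End LargeSieve.

(** * The sieve weights *)

Section Sieve.
Context {R : realType}.
Implicit Types (X Y Z : seq (R * nat)) (Q : seq nat) (p q x n : nat).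

(** A pair (c, d) stands for the function c 1_{d | n}. Lists of pairs, rather than functions, keep
    the moduli and the coefficient norm accessible. *)
Definition scal (c : R) X : seq (R * nat) := [seq (c * w.1, w.2) | w <- X].
Definition dil p X : seq (R * nat) := [seq (w.1, (p * w.2)%N) | w <- X].

Definition ev X n : R := \sum_(w <- X) w.1 * (w.2 %| n)%:R.
Definition l1norm X : R := \sum_(w <- X) `|w.1|.

(* [twform q X Y] is the coefficient of [e(n / q)] in the Fourier expansion of the
   periodic function [n |-> ev X n * ev Y n]. *)
Definition twform q X Y : R := \sum_(w <- X) \sum_(v <- Y)
  w.1 * v.1 * ((q %| lcmn w.2 v.2)%:R / (lcmn w.2 v.2)%:R).

(* [ev (expansion Q x)] is the sum over the squarefree [d <= x] composed of primes
   of [Q] of [mu(d) c_d(n) / phi(d)], where [c_d] is the Ramanujan sum. *)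
Fixpoint expansion Q x : seq (R * nat) :=
  match Q with
  | [::] => if (0 < x)%N then [:: (1, 1%N)] else [::]
  | p :: Q' => expansion Q' x ++ scal (p%:R - 1)^-1 (expansion Q' (x %/ p)) ++
      scal (- (p%:R / (p%:R - 1))) (dil p (expansion Q' (x %/ p)))
  end.

(** The sum of 1 / phi(d) over the same squarefree d as in [expansion]: the constant G. *)
Fixpoint mass Q x : R :=
  match Q with
  | [::] => (0 < x)%N%:R
  | p :: Q' => mass Q' x + mass Q' (x %/ p) / (p%:R - 1)
  end.

Lemma prime_sub1_gt0 p : prime p -> 0 < p%:R - 1 :> R.
Proof. by move=> pp; rewrite subr_gt0 ltr1n prime_gt1. Qed.

Lemma ev_cat X Y n : ev (X ++ Y) n = ev X n + ev Y n.
Proof. by rewrite /ev big_cat. Qed.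

Lemma ev_scal c X n : ev (scal c X) n = c * ev X n.
Proof. by rewrite /ev /scal big_map mulr_sumr; apply: eq_bigr => w _ /=; rewrite mulrA. Qed.

Lemma form_catl q X Y Z : twform q (X ++ Y) Z = twform q X Z + twform q Y Z.
Proof. by rewrite /twform big_cat. Qed.

Lemma form_sym q X Y : twform q X Y = twform q Y X.
Proof.
rewrite /twform exchange_big; apply: eq_bigr => v _; apply: eq_bigr => w _ /=.
by rewrite (mulrC w.1) lcmnC.
Qed.

Lemma form_catr q X Y Z : twform q X (Y ++ Z) = twform q X Y + twform q X Z.
Proof. by rewrite form_sym form_catl !(form_sym _ X). Qed.

Lemma form_scall q c X Y : twform q (scal c X) Y = c * twform q X Y.
Proof.
rewrite /twform /scal big_map mulr_sumr; apply: eq_bigr => w _ /=.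
by rewrite mulr_sumr; apply: eq_bigr => v _; rewrite !mulrA.
Qed.

Lemma form_scalr q c X Y : twform q X (scal c Y) = c * twform q X Y.
Proof. by rewrite form_sym form_scall form_sym. Qed.

Definition free p X := forall w, w \in X -> coprime p w.2.

Lemma lcmn_mul_coprime p a b : coprime p b -> lcmn (p * a) b = (p * lcmn a b)%N.
Proof.
move=> cop; rewrite /lcmn gcdnC Gauss_gcdr 1?coprime_sym// gcdnC muln_divA ?mulnA//.
by rewrite dvdn_mulr// dvdn_gcdl.
Qed.

(** With the twist p q, a term with at least one dilated side has lcm divisible by p and yields p^-1
    times the form at q; a term with none vanishes ([form_free0]). This holds whether or not p
    divides q. *)
Lemma form_dil p q X Y : (0 < p)%N -> free p Y ->
  twform (p * q) (dil p X) Y = p%:R^-1 * twform q X Y.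
Proof.
move=> p0 fY; rewrite /twform /dil big_map mulr_sumr; apply: eq_bigr => w _ /=.
rewrite mulr_sumr; apply: eq_big_seq => v vY /=.
rewrite lcmn_mul_coprime ?fY// dvdn_pmul2l// natrM invfM.
by rewrite [_ * (p%:R^-1 * _)]mulrCA [RHS]mulrCA.
Qed.

Lemma form_dil1 p X Y : free p Y -> twform 1 (dil p X) Y = p%:R^-1 * twform 1 X Y.
Proof.
move=> fY; rewrite /twform /dil big_map mulr_sumr; apply: eq_bigr => w _ /=.
rewrite mulr_sumr; apply: eq_big_seq => v vY /=.
rewrite lcmn_mul_coprime ?fY// !dvd1n natrM invfM.
by rewrite [_ * (p%:R^-1 * _)]mulrCA [RHS]mulrCA.
Qed.

Lemma form_dilr p q X Y : (0 < p)%N -> free p X ->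
  twform (p * q) X (dil p Y) = p%:R^-1 * twform q X Y.
Proof. by move=> p0 fX; rewrite form_sym form_dil// form_sym. Qed.

Lemma form_dil1r p X Y : free p X -> twform 1 X (dil p Y) = p%:R^-1 * twform 1 X Y.
Proof. by move=> fX; rewrite form_sym form_dil1// form_sym. Qed.

Lemma form_dil2 p q X Y : (0 < p)%N -> twform (p * q) (dil p X) (dil p Y) = p%:R^-1 * twform q X Y.
Proof.
move=> p0; rewrite /twform /dil big_map mulr_sumr; apply: eq_bigr => w _ /=.
rewrite big_map mulr_sumr; apply: eq_big_seq => v vY /=.
rewrite -muln_lcmr dvdn_pmul2l// natrM invfM.
by rewrite [_ * (p%:R^-1 * _)]mulrCA [RHS]mulrCA.
Qed.

Lemma form_dil21 p X Y : twform 1 (dil p X) (dil p Y) = p%:R^-1 * twform 1 X Y.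
Proof.
rewrite /twform /dil big_map mulr_sumr; apply: eq_bigr => w _ /=.
rewrite big_map mulr_sumr; apply: eq_big_seq => v vY /=.
rewrite -muln_lcmr !dvd1n natrM invfM.
by rewrite [_ * (p%:R^-1 * _)]mulrCA [RHS]mulrCA.
Qed.

Lemma form_free0 p q X Y : prime p -> free p X -> free p Y -> twform (p * q) X Y = 0.
Proof.
move=> pp fX fY; rewrite /twform big1_seq// => w /= wX; rewrite big1_seq// => v /= vY.
suff /negbTE -> : ~~ (p * q %| lcmn w.2 v.2)%N by rewrite mul0r mulr0.
apply/negP => /(dvdn_trans (dvdn_mulr q (dvdnn p))) h.
have : (p %| w.2 * v.2)%N by rewrite (dvdn_trans h)// dvdn_lcm dvdn_mulr ?dvdn_mull.
have := fX _ wX; have := fY _ vY; rewrite !prime_coprime// Euclid_dvdM//.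
by move=> /negbTE -> /negbTE ->.
Qed.

Lemma expansion_free p Q x : prime p -> all prime Q -> p \notin Q -> free p (expansion Q x).
Proof.
move=> pp; elim: Q x => [|r Q IH] x /=.
  by move=> _ _ w; case: ifP => // _; rewrite inE => /eqP -> /=; rewrite coprimen1.
move=> /andP[pr aQ]; rewrite inE negb_or => /andP[pr' pQ] w.
rewrite !mem_cat => /or3P[/IH->//|/mapP[v /IH h ->]|/mapP[v /mapP[v' /IH h ->] ->]] /=.
  exact: h.
by rewrite coprimeMr h// andbT prime_coprime// dvdn_prime2.
Qed.

Lemma expansion_le Q x w : all prime Q -> w \in expansion Q x -> (0 < w.2 <= x)%N.
Proof.
elim: Q x w => [|p Q IH] x w /=.
  by move=> _; case: ifP => // x0; rewrite inE => /eqP ->.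
move=> /andP[pp aQ]; have p0 := prime_gt0 pp.
rewrite !mem_cat => /or3P[/IH->//|/mapP[v /IH h ->]|/mapP[v /mapP[v' /IH h ->] ->]] /=.
  by have /andP[-> /leq_trans->] := h aQ; rewrite // leq_div.
have /andP[v0 vx] := h aQ; rewrite muln_gt0 p0 v0 /=.
by rewrite (leq_trans (_ : _ <= p * (x %/ p))%N) ?leq_mul2l ?vx ?orbT// mulnC leq_trunc_div.
Qed.

Lemma mass_ge0 Q x : all prime Q -> 0 <= mass Q x.
Proof.
elim: Q x => [|p Q IH] x //= /andP[pp aQ].
by rewrite addr_ge0 ?IH// divr_ge0 ?IH// ltW// prime_sub1_gt0.
Qed.

Lemma mass_ge1 Q x : all prime Q -> (0 < x)%N -> 1 <= mass Q x.
Proof.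
elim: Q => [|p Q IH] /=; first by move=> _ ->.
move=> /andP[pp aQ] x0; rewrite -[leLHS]addr0 lerD ?IH//.
by rewrite divr_ge0 ?mass_ge0// ltW// prime_sub1_gt0.
Qed.

(** Orthogonality of Ramanujan sums. In the recursion, [chi p] has mean 0, so the cross terms
    cancel, and [chi p] squared has mean 1 / (p - 1). *)
Lemma form_expansion Q x y : all prime Q -> uniq Q -> (y <= x)%N ->
  twform 1 (expansion Q x) (expansion Q y) = mass Q y.
Proof.
elim: Q x y => [|p Q IH] x y /=.
  move=> _ _ yx; rewrite /twform; case: (posnP y) yx => [->|y0 yx] /=.
    by move=> _; rewrite exchange_big big_nil.
  by rewrite (leq_trans y0 yx) !big_seq1 /= lcm1n ?dvd1n ?divr1 ?mulr1 ?invr1 ?mulr1.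
move=> /andP[pp aQ] /andP[pQ uQ] yx; have p1 := prime_sub1_gt0 _ pp.
have p0 : 0 < p%:R :> R by rewrite ltr0n prime_gt0.
have fr t := expansion_free p Q t pp aQ pQ.
rewrite !form_catl !form_catr !(form_scall, form_scalr).
rewrite !(form_dil21, form_dil1 _ _ _ (fr _), form_dil1r _ _ _ (fr _)).
rewrite -(IH x y)// -(IH (x %/ p)%N (y %/ p)%N) ?leq_div2r//.
by field; rewrite !lt0r_neq0.
Qed.

(** This is mu(p) c_p(n) / phi(p), the local factor of the weights. *)
Definition chi p n : R := if (p %| n)%N then -1 else (p%:R - 1)^-1.

Lemma ev_expansion_cons p Q x n : prime p -> all prime Q -> p \notin Q ->
  ev (expansion (p :: Q) x) n = ev (expansion Q x) n + chi p n * ev (expansion Q (x %/ p)) n.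
Proof.
move=> pp aQ pQ; have p1 := prime_sub1_gt0 _ pp.
rewrite /= !ev_cat !ev_scal; congr (_ + _).
have -> : ev (dil p (expansion Q (x %/ p))) n = (p %| n)%:R * ev (expansion Q (x %/ p)) n.
  rewrite /ev /dil big_map mulr_sumr; apply: eq_big_seq => w wE /=.
  rewrite Gauss_dvd; last exact: (expansion_free p Q (x %/ p)%N).
  by case: (p %| n)%N; rewrite /= ?mul1r ?mul0r ?mulr0.
rewrite /chi; case: (p %| n)%N; last by rewrite mul0r mulr0 addr0.
by rewrite mul1r; field; rewrite lt0r_neq0.
Qed.

(** The function does not depend on the order of the primes, though the list does. This brings a
    prime factor of the denominator to the head, where the recursion acts. *)
Lemma ev_expansion_rem p Q x n : all prime Q -> uniq Q -> p \in Q ->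
  ev (expansion Q x) n = ev (expansion (p :: rem p Q) x) n.
Proof.
elim: Q x => [|r Q IH] x // /andP[pr aQ] /andP[rQ uQ]; rewrite inE.
have [->|pr' /= pQ] := eqVneq p r; first by rewrite /= eqxx.
rewrite eq_sym (negbTE pr').
have aR : all prime (rem p Q) by apply/allP => k /mem_rem /(allP aQ).
have pp : prime p by exact: (allP aQ).
have pR : p \notin rem p Q by rewrite mem_rem_uniq// inE eqxx.
have rR : r \notin rem p Q by apply: contra rQ => /mem_rem.
rewrite (ev_expansion_cons r Q)// (ev_expansion_cons p (r :: _)) /= ?pr ?aR//; last first.
  by rewrite inE negb_or pr'.
rewrite !IH// !(ev_expansion_cons p (rem p Q))// -!/(expansion (r :: rem p Q) _).
rewrite !(ev_expansion_cons r (rem p Q))// -!divnMA (mulnC r p).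
ring.
Qed.

Lemma mass_rem p Q x : p \in Q -> mass Q x = mass (p :: rem p Q) x.
Proof.
elim: Q x => [|r Q IH] x //; rewrite inE.
have [->|pr' /= pQ] := eqVneq p r; first by rewrite /= eqxx.
rewrite eq_sym (negbTE pr') /= !IH//= -!divnMA (mulnC r p); ring.
Qed.

Lemma ev_expansion_prime Q x n : all prime Q -> uniq Q -> prime n -> n \notin Q ->
  ev (expansion Q x) n = mass Q x.
Proof.
elim: Q x => [|p Q IH] x aQ uQ pn nQ.
  by rewrite /ev /=; case: ifP => _; rewrite ?big_nil// big_seq1 /= dvd1n mulr1.
move: aQ uQ nQ => /= /andP[pp aQ] /andP[pQ uQ]; rewrite inE negb_or => /andP[np nQ].
rewrite -/(expansion (p :: Q) x) ev_expansion_cons// !IH// /chi dvdn_prime2// eq_sym (negbTE np).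
by rewrite mulrC.
Qed.

Lemma l1norm_cat X Y : l1norm (X ++ Y) = l1norm X + l1norm Y.
Proof. by rewrite /l1norm big_cat. Qed.

Lemma l1norm_scal c X : l1norm (scal c X) = `|c| * l1norm X.
Proof. by rewrite /l1norm big_map mulr_sumr; apply: eq_bigr => w _; rewrite normrM. Qed.

Lemma l1norm_dil p X : l1norm (dil p X) = l1norm X.
Proof. by rewrite /l1norm big_map. Qed.

Lemma l1norm_ge0 X : 0 <= l1norm X.
Proof. exact: sumr_ge0. Qed.

Lemma l1norm_expansion_cons p Q x : prime p ->
  l1norm (expansion (p :: Q) x) =
  l1norm (expansion Q x) + (p%:R + 1) / (p%:R - 1) * l1norm (expansion Q (x %/ p)).
Proof.
move=> pp; have p1 := prime_sub1_gt0 _ pp.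
rewrite /= !l1norm_cat !l1norm_scal l1norm_dil normrN normfV normrM normfV (gtr0_norm p1).
by rewrite (ger0_norm (ler0n R p)) -mulrDl; congr (_ + _ * _); field; rewrite lt0r_neq0.
Qed.

(** Each prime costs (p + 1) / (p - 1) and lowers the cutoff to x / p; the resulting 1 + (p + 1) /
    (p (p - 1)) is written in the shape of [prod_prime_le] with j = 2. *)
Lemma l1norm_expansion_le Q x : all prime Q ->
  l1norm (expansion Q x) <=
  x%:R * \prod_(p <- Q) (1 + (p%:R^-1 + 2 / (p%:R * (p%:R - 1)))).
Proof.
elim: Q x => [|p Q IH] x.
  rewrite big_nil mulr1 /l1norm /= => _; case: ifP => [x0|_]; last by rewrite big_nil.
  by rewrite big_seq1 normr1 ler1n.
move=> /= /andP[pp aQ]; have p1 := prime_sub1_gt0 _ pp; have p0 : 0 < p%:R :> R by lra.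
rewrite -/(expansion (p :: Q) x) l1norm_expansion_cons// big_cons.
set P := \prod_(_ <- _) _ in IH *.
have P0 : 0 <= P.
  rewrite /P big_seq; apply: prodr_ge0 => q /(allP aQ) pq.
  have q1 := prime_sub1_gt0 _ pq; have q0 : 0 < q%:R :> R by lra.
  by rewrite addr_ge0// addr_ge0 ?invr_ge0// divr_ge0//; apply: mulr_ge0; exact: ltW.
have h : (x %/ p)%:R <= x%:R / p%:R :> R.
  by rewrite ler_pdivlMr// -natrM ler_nat leq_trunc_div.
apply: le_trans (_ : x%:R * P + (p%:R + 1) / (p%:R - 1) * (x%:R / p%:R * P) <= _).
  rewrite lerD ?IH// ler_wpM2l//; first by apply: divr_ge0; lra.
  by apply: le_trans (IH _ aQ) _; rewrite ler_wpM2r.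
rewrite le_eqVlt; apply/orP; left; apply/eqP; field.
by rewrite !lt0r_neq0.
Qed.

Lemma mass_le_l1norm Q x : all prime Q -> mass Q x <= l1norm (expansion Q x).
Proof.
elim: Q x => [|p Q IH] x.
  by rewrite /l1norm /= => _; case: ifP => _; rewrite ?big_nil// big_seq1 normr1.
move=> /= /andP[pp aQ]; have p1 := prime_sub1_gt0 _ pp; have p0 := ler0n R p.
rewrite -/(expansion (p :: Q) x) l1norm_expansion_cons// lerD ?IH//.
apply: le_trans (_ : l1norm (expansion Q (x %/ p)) / (p%:R - 1) <= _).
  by rewrite ler_wpM2r ?IH// invr_ge0 ltW.
rewrite mulrC ler_wpM2r ?l1norm_ge0// -[leLHS]mul1r ler_wpM2r ?invr_ge0 ?(ltW p1)//; lra.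
Qed.

End Sieve.

(** * Twisted means of the weights and a lower bound for their mass *)

Section SieveBounds.
Context {R : realType}.
Implicit Types (X Y : seq (R * nat)) (Q : seq nat) (p q x n l : nat).

Lemma sum_dvdn (V : zmodType) (f : nat -> V) l x : (0 < l)%N ->
  \sum_(0 <= n < x.+1 | (l %| n)%N) f n = \sum_(0 <= k < (x %/ l).+1) f (l * k)%N.
Proof.
move=> l0; elim: x => [|x IH]; first by rewrite div0n big_mkcond !big_nat1 dvdn0 muln0.
rewrite big_mkcond big_nat_recr//= -big_mkcond IH divnS//.
case: ifP => h; last by rewrite addr0 add0n.
rewrite add1n [RHS]big_nat_recr//=; congr (_ + f _).
by have := divnS x l0; rewrite h add1n => <-; rewrite mulnC divnK.
Qed.

Lemma sum_dvdn_cos l q L : (0 < q)%N -> (0 < l)%N -> (0 < L)%N -> (l %| L)%N -> (q %| L)%N ->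
  \sum_(0 <= n < L) (l %| n)%:R * cos (2 * pi * (n%:R / q%:R)) =
  L%:R * ((q %| l)%:R / l%:R) :> R.
Proof.
move=> q0 l0 L0 lL qL.
have q0' : q%:R != 0 :> R by rewrite pnatr_eq0 -lt0n.
have l0' : l%:R != 0 :> R by rewrite pnatr_eq0 -lt0n.
have -> : \sum_(0 <= n < L) (l %| n)%:R * cos (2 * pi * (n%:R / q%:R)) =
   complex.Re (geom (L %/ l) (l%:R / q%:R : R)).
  transitivity (\sum_(0 <= n < L | (l %| n)%N) cos (2 * pi * (n%:R / q%:R)) : R).
    rewrite [RHS]big_mkcond; apply: eq_bigr => n _.
    by case: ifP => _; rewrite ?mul1r ?mul0r.
  have [k kE] : exists k, (L %/ l = k.+1)%N.
    by exists (L %/ l).-1; rewrite prednK// divn_gt0// dvdn_leq.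
  have -> : L = (L.-1).+1 by rewrite prednK.
  rewrite sum_dvdn// (_ : (L.-1 %/ l).+1 = L %/ l)%N; last first.
    have LE : L = (l * k.+1)%N by rewrite -kE mulnC divnK.
    rewrite kE LE; congr _.+1; rewrite mulnS.
    have -> : ((l + l * k).-1 = k * l + l.-1)%N by rewrite mulnC; lia.
    by rewrite divnMDl// divn_small ?addn0// prednK.
  rewrite prednK// /geom raddf_sum /=; apply: eq_bigr => i _.
  by rewrite natrM [l%:R * _ / _]mulrAC.
have [ql|ql] := boolP (q %| l)%N.
  have -> : geom (L %/ l) (l%:R / q%:R : R) = (L %/ l)%:R.
    rewrite /geom (eq_bigr (fun=> 1)) ?sumr_const_nat ?subn0// => i _.
    have -> : l%:R / q%:R * i%:R = ((l %/ q) * i)%N%:R :> R.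
      by rewrite natrM natf_div.
    by rewrite expi_nat.
  by rewrite -(rmorph_nat (real_complex R)) /= natf_div// mul1r.
rewrite mul0r mulr0.
suff -> : geom (L %/ l) (l%:R / q%:R : R) = 0 by [].
apply/eqP; have := geom_mul (L %/ l) (l%:R / q%:R : R).
have -> : l%:R / q%:R * (L %/ l)%:R = (L %/ q)%:R :> R.
  by rewrite !natf_div//; field; rewrite q0'.
rewrite expi_nat subrr => /eqP; rewrite mulf_eq0 => /orP[/eqP e|//].
have : 0 < sin (pi * (l%:R / q%:R)) ^+ 2 :> R.
  apply: sin_pi_sqr_gt0 => k; rewrite subr_eq0; apply: contra ql => /eqP h.
  have : l%:Z = k * q%:Z.
    by apply: (@intr_inj R); rewrite rmorphM /= -h !pmulrn divfK// -pmulrn.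
  by move=> e1; rewrite -[(q %| l)%N]/(`|q%:Z| %| `|l%:Z|)%N -dvdzE e1 dvdz_mull.
have := normc_1Bexpi (l%:R / q%:R : R); rewrite e Normc.normc0; lra.
Qed.

(** Realises the formal coefficient as a mean over a common period, where Cauchy-Schwarz is
    available. *)
Lemma form_average q X Y L : (0 < q)%N -> (0 < L)%N -> (q %| L)%N ->
  (forall w v, w \in X -> v \in Y -> (0 < lcmn w.2 v.2)%N && (lcmn w.2 v.2 %| L)%N) ->
  L%:R * twform q X Y = \sum_(0 <= n < L) ev X n * ev Y n * cos (2 * pi * (n%:R / q%:R)).
Proof.
move=> q0 L0 qL h.
transitivity (\sum_(w <- X) \sum_(v <- Y) w.1 * v.1 *
    \sum_(0 <= n < L) (lcmn w.2 v.2 %| n)%:R * cos (2 * pi * (n%:R / q%:R)) : R).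
  rewrite /twform mulr_sumr; apply: eq_big_seq => w wX; rewrite mulr_sumr.
  apply: eq_big_seq => v vY; have /andP[h1 h2] := h w v wX vY.
  by rewrite sum_dvdn_cos// mulrCA.
rewrite [RHS](eq_bigr (fun n => \sum_(w <- X) \sum_(v <- Y) w.1 * v.1 *
    ((lcmn w.2 v.2 %| n)%:R * cos (2 * pi * (n%:R / q%:R))))); last first.
  move=> n _; rewrite /ev !mulr_suml; apply: eq_bigr => w _.
  rewrite mulr_sumr mulr_suml; apply: eq_bigr => v _.
  by rewrite dvdn_lcm; case: (_ %| _)%N; case: (_ %| _)%N => /=; ring.
rewrite [RHS]exchange_big; apply: eq_bigr => w _ /=.
rewrite [RHS]exchange_big; apply: eq_bigr => v _ /=.
by rewrite mulr_sumr.
Qed.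

Lemma form_amgm q X Y x (s : R) : (0 < q)%N -> 0 < s ->
  (forall w, w \in X -> (0 < w.2 <= x)%N) -> (forall w, w \in Y -> (0 < w.2 <= x)%N) ->
  `|twform q X Y| <= (twform 1 X X / s + s * twform 1 Y Y) / 2.
Proof.
(* A common period: every lcm of two moduli is at most x * x, so it divides the factorial. *)
move=> q0 s0 hX hY; pose L := (q * (x * x)`!)%N.
have L0 : (0 < L)%N by rewrite muln_gt0 q0 fact_gt0.
have hl (w v : R * nat) : (0 < w.2 <= x)%N -> (0 < v.2 <= x)%N ->
    (0 < lcmn w.2 v.2)%N && (lcmn w.2 v.2 %| L)%N.
  move=> /andP[w0 wx] /andP[v0 vx]; rewrite lcmn_gt0 w0 v0 /= dvdn_mull// dvdn_fact//.
  by rewrite lcmn_gt0 w0 v0 /= (leq_trans (_ : _ <= w.2 * v.2)%N) ?leq_mul// dvdn_leq ?muln_gt0 ?w0//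
    dvdn_lcm dvdn_mulr ?dvdn_mull.
have L0' : 0 < L%:R :> R by rewrite ltr0n.
have one n : cos (2 * pi * (n%:R / 1%:R)) = 1 :> R.
  by have := expi_nat n (R := R); rewrite divr1 => /(congr1 (@complex.Re R)).
have eX : L%:R * twform 1 X X = \sum_(0 <= n < L) ev X n ^+ 2.
  rewrite (@form_average _ _ _ L)//; last by move=> w v /hX ? /hX ?; exact: hl.
  by apply: eq_bigr => n _; rewrite one mulr1.
have eY : L%:R * twform 1 Y Y = \sum_(0 <= n < L) ev Y n ^+ 2.
  rewrite (@form_average _ _ _ L)//; last by move=> w v /hY ? /hY ?; exact: hl.
  by apply: eq_bigr => n _; rewrite one mulr1.
rewrite -(ler_pM2l L0') -[X in X * `|_|](gtr0_norm L0') -normrM.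
rewrite (@form_average _ _ _ L)//; last 2 first.
- by rewrite dvdn_mulr.
- by move=> w v /hX ? /hY ?; exact: hl.
apply: le_trans (ler_norm_sum _ _ _) _.
have -> : L%:R * ((twform 1 X X / s + s * twform 1 Y Y) / 2) =
   \sum_(0 <= n < L) ((ev X n ^+ 2 / s + s * ev Y n ^+ 2) / 2).
  rewrite -mulr_suml big_split /= -mulr_suml -mulr_sumr -eX -eY.
  by field; rewrite lt0r_neq0.
apply: ler_sum => n _; rewrite !normrM.
apply: le_trans (_ : `|ev X n| * `|ev Y n| <= _).
  by rewrite -[leRHS]mulr1 ler_wpM2l ?mulr_ge0// cos_max.
rewrite -[ev X n ^+ 2]real_normK ?num_real// -[ev Y n ^+ 2]real_normK ?num_real//.
move: (`|ev X n|) (`|ev Y n|) => a b.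
rewrite -subr_ge0 (_ : _ - _ = (a - s * b) ^+ 2 / (2 * s)); last by field; rewrite lt0r_neq0.
by rewrite divr_ge0 ?sqr_ge0// mulr_ge0// ltW.
Qed.

(* [u + chi v] with [u = ev (expansion Q x)] and [v = ev (expansion Q (x %/ p))]:
   the twisted average picks up one factor [1 / (p - 1)]; the rest is Cauchy-Schwarz,
   using that [u - v] is orthogonal to [v]. *)
Lemma form_twist_le p q Q x : all prime (p :: Q) -> uniq (p :: Q) -> (0 < q)%N ->
  `|twform (p * q) (expansion (p :: Q) x) (expansion (p :: Q) x)| <=
  7 / 6 / (p%:R - 1) * (mass (p :: Q) x : R).
Proof.
move=> aQ' uQ' q0; move: (aQ') (uQ') => /= /andP[pp aQ] /andP[pQ uQ].
have p1 : 1 <= p%:R - 1 :> R by rewrite lerBrDr -[1 + 1]/(2%:R) ler_nat prime_gt1.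
have p0 : 0 < p%:R :> R by lra.
have pn := prime_gt0 pp.
have fr t : free p (expansion Q t : seq (R * nat)) := expansion_free p Q t pp aQ pQ.
set U : seq (R * nat) := expansion Q x; set V : seq (R * nat) := expansion Q (x %/ p).
set a := (p%:R - 1)^-1 : R.
have a0 : 0 < a by rewrite invr_gt0; lra.
have a1 : a <= 1 by rewrite invf_le1; lra.
have ap : p%:R * a = 1 + a by rewrite /a; field; lra.
have E : twform (p * q) (U ++ scal a V ++ scal (- (p%:R * a)) (dil p V))
    (U ++ scal a V ++ scal (- (p%:R * a)) (dil p V)) =
    - a * twform q (scal 2 U ++ scal (- (1 - a)) V) V.
  rewrite !form_catl !form_catr !(form_scall, form_scalr).
  rewrite !(form_dil2 _ _ _ _ pn, form_dil _ _ _ _ pn (fr _), form_dilr _ _ _ _ pn (fr _)).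
  rewrite !(form_free0 _ _ _ _ pp (fr _) (fr _)) (form_sym q V U) /a.
  by field; rewrite !lt0r_neq0//; lra.
rewrite -/U -/V -/a E normrM normrN (gtr0_norm a0) [7 / 6 / _]mulrC -mulrA ler_pM2l//.
have hU w : w \in U -> (0 < w.2 <= x)%N by exact: expansion_le.
have hV w : w \in V -> (0 < w.2 <= x)%N.
  by move=> /(expansion_le _ _ _ aQ)/andP[-> /leq_trans]; apply; rewrite leq_div.
(* With parameter s the bound is 2 / s times g = [mass Q x], plus (s - 3 / s) / 2 times g' =
   [mass Q (x %/ p)], plus terms of order a g'. The value 12/7, just below sqrt 3, makes the middle
   coefficient negative and 2 / s = 7/6; the term a g' in the mass of p :: Q absorbs the rest. *)
apply: le_trans (@form_amgm q _ _ x (12 / 7) q0 _ _ hV) _; first by lra.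
  by move=> w; rewrite mem_cat => /orP[] /mapP[v ? ->] /=; [exact: hU|exact: hV].
have eUU : twform 1 U U = mass Q x by exact: form_expansion.
have eUV : twform 1 U V = mass Q (x %/ p) by apply: form_expansion => //; rewrite leq_div.
have eVV : twform 1 V V = mass Q (x %/ p) by exact: form_expansion.
rewrite !form_catl !form_catr !(form_scall, form_scalr) (form_sym 1 V U) eUU eUV eVV.
have g0 : 0 <= mass Q (x %/ p) :> R by exact: mass_ge0.
have : 0 <= a * mass Q (x %/ p) by rewrite mulr_ge0// ltW.
have : a * (a * mass Q (x %/ p)) <= a * mass Q (x %/ p) by rewrite ler_piMl// mulr_ge0// ltW.
move: (mass Q x : R) (mass Q (x %/ p) : R) g0 => g g' g0 h1 h2.
have -> : g' / (p%:R - 1) = a * g' by rewrite mulrC.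
lra.
Qed.

Definition smooth Q n := all (mem Q) (primes n).

(** The link between [mass] and the harmonic sum. The index 0 counts as smooth, but contributes its
    inverse, 0. *)
Definition smooth_sum Q x : R := \sum_(0 <= n < x.+1 | smooth Q n) n%:R^-1.

Lemma smooth_sum_mono Q x y : (x <= y)%N -> smooth_sum Q x <= smooth_sum Q y.
Proof.
move=> xy; rewrite /smooth_sum [leRHS](big_cat_nat (n := x.+1))//= lerDl.
by apply: sumr_ge0 => n _; rewrite invr_ge0.
Qed.

Lemma smooth_sum_cons p Q x : prime p ->
  smooth_sum (p :: Q) x <= smooth_sum Q x + p%:R^-1 * smooth_sum (p :: Q) (x %/ p).
Proof.
move=> pp; rewrite {1}/smooth_sum (bigID (fun n => (p %| n)%N)) /= addrC lerD//.
  rewrite big_mkcond [leRHS]big_mkcond /=; apply: ler_sum_nat => n /andP[_ nx].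
  case: ifP => [/andP[sn pn]|_]; last by case: ifP => _ //; rewrite invr_ge0.
  suff -> : smooth Q n by [].
  apply/allP => r rn; have := allP sn r rn; rewrite !inE => /orP[/eqP e|//].
  by move: rn pn; rewrite mem_primes e => /and3P[_ _ ->].
rewrite big_mkcondl /= sum_dvdn ?prime_gt0// /smooth_sum mulr_sumr [leRHS]big_mkcond /=.
apply: ler_sum_nat => k _; case: ifP => [s|_]; last by case: ifP => _ //; rewrite mulr_ge0 ?invr_ge0.
rewrite natrM invfM; case: (posnP k) => [->|k0]; first by rewrite invr0 mulr0.
suff -> : smooth (p :: Q) k by [].
apply/allP => r rk; apply: (allP s); move: rk; rewrite !mem_primes => /and3P[-> _ rk].
by rewrite muln_gt0 prime_gt0// k0 dvdn_mull.
Qed.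

Lemma smooth_sum0 Q : smooth_sum Q 0 = 0.
Proof. by rewrite /smooth_sum big_mkcond big_nat1 invr0. Qed.

(** Iterating [smooth_sum_cons] sums the geometric series of p^-1; the strong induction ends because
    x / p < x. *)
Lemma smooth_sum_cons_le p Q x : prime p ->
  smooth_sum (p :: Q) x <= p%:R / (p%:R - 1) * smooth_sum Q x.
Proof.
move=> pp; have p1 : 0 < p%:R - 1 :> R := prime_sub1_gt0 p pp.
have [m] := ubnP x; elim: m x => // m IH x; rewrite ltnS => xm.
case: (posnP x) => [->|x0]; first by rewrite !smooth_sum0 mulr0.
have h : (x %/ p < x)%N by rewrite ltn_Pdiv// prime_gt1.
apply: le_trans (smooth_sum_cons p Q x pp) _.
have h1 := IH (x %/ p)%N (leq_trans h xm).
have h2 : p%:R / (p%:R - 1) * smooth_sum Q (x %/ p) <= p%:R / (p%:R - 1) * smooth_sum Q x.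
  by rewrite ler_wpM2l ?divr_ge0 ?(ltW p1)// smooth_sum_mono// ltnW.
apply: le_trans (_ : smooth_sum Q x + p%:R^-1 * (p%:R / (p%:R - 1) * smooth_sum Q x) <= _).
  by rewrite lerD2l ler_wpM2l ?invr_ge0// (le_trans h1).
by rewrite le_eqVlt; apply/orP; left; apply/eqP; field; rewrite !lt0r_neq0//; lra.
Qed.

(** 1 / phi(d) is the sum of 1 / n over all n whose squarefree kernel is d, and the kernel of n is
    at most n. *)
Lemma smooth_sum_le_mass Q x : all prime Q -> smooth_sum Q x <= mass Q x.
Proof.
elim: Q x => [|p Q IH] x /=.
  move=> _; case: x => [|x]; first by rewrite smooth_sum0.
  rewrite /smooth_sum big_mkcond big_ltn//= big_ltn//= big_nat big1 ?addr0.
    by rewrite invr0 invr1 add0r.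
  move=> n /andP[n1 _]; case: ifP => //; rewrite /smooth.
  case E : (primes n) => [|r s] //=; have := E; move/eqP; rewrite primes_eq0; lia.
move=> /andP[pp aQ]; have p1 : 0 < p%:R - 1 :> R := prime_sub1_gt0 p pp.
apply: le_trans (smooth_sum_cons p Q x pp) _; rewrite lerD ?IH//.
apply: le_trans (_ : p%:R^-1 * (p%:R / (p%:R - 1) * mass Q (x %/ p)) <= _).
  rewrite ler_wpM2l ?invr_ge0//; apply: le_trans (smooth_sum_cons_le _ _ _ pp) _.
  by rewrite ler_wpM2l ?IH// divr_ge0// ltW.
by rewrite le_eqVlt; apply/orP; left; apply/eqP; field; rewrite !lt0r_neq0//; lra.
Qed.

Lemma smooth_sum_cat S Q x : all prime S ->
  smooth_sum (S ++ Q) x <= (\prod_(p <- S) (p%:R / (p%:R - 1))) * smooth_sum Q x.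
Proof.
elim: S => [|p S IH] /=; first by rewrite big_nil mul1r.
move=> /andP[pp aS]; have p1 : 0 < p%:R - 1 :> R := prime_sub1_gt0 p pp.
apply: le_trans (smooth_sum_cons_le _ _ _ pp) _; rewrite big_cons -[leRHS]mulrA.
by rewrite ler_wpM2l ?IH// divr_ge0// ltW.
Qed.

Definition primes_between y z := [seq p <- index_iota y z | prime p].

Lemma all_primes_between y z : all prime (primes_between y z).
Proof. exact: filter_all. Qed.

Lemma uniq_primes_between y z : uniq (primes_between y z).
Proof. by rewrite filter_uniq ?iota_uniq. Qed.

Lemma mem_primes_between y z p : (p \in primes_between y z) = prime p && (y <= p < z)%N.
Proof. by rewrite mem_filter mem_index_iota. Qed.

(** Every n <= z is composed of primes up to z, so the harmonic sum is a smooth sum; the primes up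
    to y are removed at the cost of their Euler factors. *)
Lemma mass_ge y z : (y <= z)%N ->
  ln z.+1%:R <= (\prod_(0 <= p < y.+1 | prime p) (p%:R / (p%:R - 1))) *
    mass (primes_between y.+1 z.+1) z :> R.
Proof.
move=> yz; set S := primes_between 0 y.+1; set Q := primes_between _ _.
rewrite -big_filter -/S.
apply: le_trans (_ : (\prod_(p <- S) (p%:R / (p%:R - 1))) * smooth_sum Q z <= _); last first.
  rewrite ler_wpM2l ?smooth_sum_le_mass ?all_primes_between//.
  rewrite big_seq prodr_ge0// => p; rewrite mem_primes_between => /andP[pp _].
  by rewrite divr_ge0// ltW// prime_sub1_gt0.
apply: le_trans (smooth_sum_cat S Q z (all_primes_between _ _)).
rewrite /smooth_sum big_mkcond /=.
apply: le_trans (_ : \sum_(0 <= n < z.+1) n%:R^-1 <= _); last first.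
  apply: ler_sum_nat => n /andP[_ nz]; rewrite ifT//.
  apply/allP => p; rewrite mem_primes => /and3P[pp n0 pn].
  have pz : (p <= z)%N by rewrite (leq_trans (dvdn_leq n0 pn)).
  by rewrite !inE mem_cat !mem_primes_between pp /= !ltnS pz andbT; case: leqP.
elim: z {yz S Q} => [|z IH]; first by rewrite big_nat1 invr0 ln1.
rewrite big_nat_recr//=.
have := @le_ln_Bln R z.+1%:R z.+2%:R; rewrite !ltr0n => /(_ isT isT).
have -> : (z.+2%:R - z.+1%:R : R) = 1 by rewrite -natrB// subSnn.
rewrite mul1r lerBlDr addrC => /le_trans; apply.
by rewrite lerD2l.
Qed.

End SieveBounds.

(** * Correlation of the sieve weights with exponentials *)

Section Correlation.
Context {R : realType}.
Implicit Types (t : R) (l z M n : nat).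
Local Notation nc := (@Normc.normc R).

Lemma exists_nearest_int t : exists k : int, `|t - k%:~R| <= 1 / 2.
Proof.
exists (Num.floor (t + 1 / 2)); have := floor_itv (t + 1 / 2).
by rewrite intrD ler_norml => /andP[]; lra.
Qed.

Lemma normc_geom_far n t (eta : R) : 0 < eta ->
  (forall k : int, eta <= `|t - k%:~R|) -> nc (geom n t) <= 2 / 3 / eta.
Proof.
move=> e0 h; have [k k2] := exists_nearest_int t.
have := normc_geom_dist n t k k2; have := h k; have := normc_ge0 (geom n t).
move: (nc _) (`|_|) => a b a0 b0 ab; rewrite ler_pdivlMr//.
by apply: le_trans ab; rewrite ler_wpM2l.
Qed.

Lemma geom_shift n t (k : int) : geom n (t + k%:~R) = geom n t.
Proof.
apply: eq_bigr => i _; rewrite mulrDl expiD.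
by rewrite -[k%:~R * i%:R]/(k%:~R * (i%:Z)%:~R) -intrM expi_int mulr1.
Qed.

Lemma geom_blocks m l t : geom (m * l) t = geom m (l%:R * t) * geom l t.
Proof.
elim: m => [|m IH]; first by rewrite mul0n /geom big_geq// [X in X * _]big_geq// mul0r.
have -> : geom (m.+1 * l) t = geom (m * l) t + expi (t * (m * l)%:R) * geom l t.
  rewrite /geom mulSn addnC (big_cat_nat (n := (m * l)%N)) ?leq_addr//=; congr (_ + _).
  rewrite -{1}[(m * l)%N]add0n big_addn addnC addnK mulr_sumr; apply: eq_bigr => i _.
  by rewrite natrD mulrDr expiD mulrC.
have -> : geom m.+1 (l%:R * t) = geom m (l%:R * t) + expi (l%:R * t * m%:R).
  by rewrite /geom big_nat_recr.
rewrite IH mulrDl; congr (_ + expi _ * _).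
by rewrite natrM; ring.
Qed.

Lemma normc_geom_sub n m t : (n <= m)%N -> nc (geom m t - geom n t) <= (m - n)%:R.
Proof.
move=> nm; rewrite /geom (big_cat_nat (n := n) _ nm)//= addrAC subrr add0r.
apply: le_trans (normc_sum _ _ _ _) _; under eq_bigr do rewrite normc_expi.
by rewrite sumr_const_nat.
Qed.

Lemma normc_invn l : nc l%:R^-1 = l%:R^-1.
Proof. by rewrite Normc.normcV normc_nat. Qed.

(** In a block of l consecutive terms the exponential is nearly constant: the block error is at most
    8 l^2 |t|, and after division by l it meets the bound 2 / (3 l |t|) for the sum over blocks.
    This gives 16/3, and the incomplete last block adds at most 1. *)
Lemma geom_multiples l M t : (0 < l)%N -> l%:R * `|t| <= 1 / 2 ->
  nc (geom (M %/ l).+1 (l%:R * t) - l%:R^-1 * geom M.+1 t) <= 7.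
Proof.
move=> l0 lt; set m := (M %/ l).+1.
have l0' : 0 < l%:R :> R by rewrite ltr0n.
have lC : l%:R != 0 :> R[i] by rewrite pnatr_eq0 -lt0n.
have ml : (M.+1 <= m * l)%N by rewrite /m ltn_ceil.
have ml' : (m * l - M.+1 <= l)%N.
  by rewrite /m mulSn; have := leq_trunc_div M l; lia.
set A := geom m _.
have -> : A - l%:R^-1 * geom M.+1 t = l%:R^-1 * (A * (l%:R - geom l t)) +
    l%:R^-1 * (geom (m * l) t - geom M.+1 t).
  by rewrite geom_blocks -/A; field.
apply: le_trans (normcD _ _) _; rewrite !Normc.normcM normc_invn.
have h1 : nc (l%:R - geom l t) <= l%:R * (8 * (l%:R * `|t|)).
  have -> : l%:R - geom l t = \sum_(0 <= i < l) (1 - expi (t * i%:R)).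
    by rewrite sumrB sumr_const_nat subn0.
  apply: le_trans (normc_sum _ _ _ _) _.
  apply: le_trans (_ : \sum_(0 <= i < l) 8 * (l%:R * `|t|) <= _); last first.
    by rewrite sumr_const_nat subn0 [leRHS]mulr_natl.
  apply: ler_sum_nat => i /andP[_ il]; apply: le_trans (normc_1Bexpi_le _) _.
  rewrite normrM (ger0_norm (ler0n R i)) mulrC (mulrC 8); apply: ler_pM => //.
  - by rewrite mulr_ge0// pi_ge0.
  - by rewrite mulrC ler_wpM2r// ler_nat ltnW.
  - by have := pihalf_lt2 R; lra.
have h2 : nc A * (l%:R * `|t|) <= 2 / 3.
  have := normc_geom_dist m (l%:R * t) 0; rewrite subr0 normrM (gtr0_norm l0').
  by move=> /(_ lt).
have h3 : nc (geom (m * l) t - geom M.+1 t) <= l%:R.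
  by apply: le_trans (normc_geom_sub _ _ _ ml) _; rewrite ler_nat.
have A0 := normc_ge0 A.
apply: le_trans (_ : l%:R^-1 * (nc A * (l%:R * (8 * (l%:R * `|t|)))) + l%:R^-1 * l%:R <= _).
  by rewrite lerD// ler_wpM2l ?invr_ge0// ler_wpM2l.
rewrite mulVf ?lt0r_neq0//.
have -> : l%:R^-1 * (nc A * (l%:R * (8 * (l%:R * `|t|)))) = 8 * (nc A * (l%:R * `|t|)).
  by field; rewrite lt0r_neq0.
lra.
Qed.

(* [q] is the denominator of a fraction close to [t], if there is one with
   denominator at most [z ^ 2]; otherwise no [l <= z ^ 2] is a multiple of [q]. *)
Lemma multiples_approx z M t : (2 < z)%N -> exists q (D : R[i]),
  [/\ (0 < q)%N, nc D <= M.+1%:R, (q = 1%N -> D = geom M.+1 t) &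
  forall l, (0 < l <= z ^ 2)%N ->
    nc (geom (M %/ l).+1 (l%:R * t) - (q %| l)%:R / l%:R * D) <= 4 / 3 * z%:R ^+ 2].
Proof.
move=> z2.
have z2' : 3 <= z%:R :> R by rewrite (ler_nat R 3).
have Z9 : 9 <= z%:R ^+ 2 :> R by nra.
set Z := z%:R ^+ 2 in Z9 *.
have lZ l : (l <= z ^ 2)%N -> l%:R <= Z by rewrite -(ler_nat R) natrX.
have Z0 : 0 < 1 / (2 * Z) by rewrite divr_gt0//; lra.
pose near q := `[< (0 < q <= z ^ 2)%N /\ exists k : int, `|q%:R * t - k%:~R| <= 1 / (2 * Z) >].
have [[q0 nq0]|far] := pselect (exists q, near q); last first.
  exists (z ^ 2).+1, 0; split => //; first by rewrite Normc.normc0.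
    by move=> [] /eqP; rewrite expn_eq0; lia.
  move=> l /andP[l0 lz].
  have /negbTE -> : ~~ ((z ^ 2).+1 %| l)%N by apply/negP => /(dvdn_leq l0); lia.
  rewrite mulr0 subr0; apply: le_trans (_ : 2 / 3 / (1 / (2 * Z)) <= _); last first.
    by rewrite le_eqVlt; apply/orP; left; apply/eqP; field; lra.
  apply: normc_geom_far => // k; rewrite leNgt; apply/negP => h; apply: far.
  by exists l; apply/asboolP; split; [rewrite l0|exists k; exact: ltW].
have : exists q, near q by exists q0.
move=> ex; case: (ex_minnP ex) => q /asboolP[/andP[qp qz] [k hk]] qmin {ex q0 nq0}.
have q0 : 0 < q%:R :> R by rewrite ltr0n.
have qC : q%:R != 0 :> R by rewrite lt0r_neq0.
set xi := t - k%:~R / q%:R.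
have xiE : q%:R * t - k%:~R = q%:R * xi by rewrite /xi; field.
have hxi : q%:R * `|xi| <= 1 / (2 * Z) by rewrite -[q%:R](gtr0_norm q0) -normrM -xiE.
exists q, (geom M.+1 xi); split => //; first exact: normc_geom_le.
  move=> q1; have -> : t = xi + k%:~R by rewrite /xi q1 divr1 subrK.
  by rewrite geom_shift.
move=> l /andP[l0 lz].
have l0' : 0 < l%:R :> R by rewrite ltr0n.
have lxi : q%:R * (l%:R * `|xi|) <= 1 / 2.
  have -> : 1 / 2 = Z * (1 / (2 * Z)) by field; lra.
  by rewrite mulrCA; apply: ler_pM => //; exact: lZ.
case: (boolP (q %| l)%N) => [ql|ql].
  have -> : geom (M %/ l).+1 (l%:R * t) = geom (M %/ l).+1 (l%:R * xi).
    have -> : l%:R * t = l%:R * xi + ((l %/ q)%:Z * k)%:~R.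
      by rewrite intrM -pmulrn natf_div// /xi; field.
    by rewrite geom_shift.
  rewrite mul1r; apply: le_trans (geom_multiples _ _ _ l0 _) _; last by lra.
  have q1 : 1 <= q%:R :> R by rewrite ler1n.
  by apply: le_trans lxi; rewrite ler_peMl// mulr_ge0// ltW.
rewrite mul0r mul0r subr0; apply: le_trans (_ : 2 / 3 / (1 / (2 * q%:R)) <= _); last first.
  have -> : 2 / 3 / (1 / (2 * q%:R)) = 4 / 3 * q%:R :> R by field.
  by rewrite ler_wpM2l//; exact: lZ.
apply: normc_geom_far; first by rewrite divr_gt0// mulr_gt0.
move=> j.
(* If l k / q were an integer, so would be r k / q for the remainder r of l modulo q, and r would
   satisfy [near], against the minimality of q. Hence l k / q is at least 1 / q away from j. *)
have nz : l%:Z * k - j * q%:Z != 0.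
  apply/eqP => e.
  have e2 : l%:R * k%:~R = j%:~R * q%:R :> R.
    by move/(congr1 (fun i : int => i%:~R : R)): e; rewrite intrB !intrM => /subr0_eq.
  pose r := (l %% q)%N; have rq : (r < q)%N by rewrite ltn_mod.
  have r0 : (0 < r)%N by rewrite lt0n.
  have : near r.
    apply/asboolP; split; first by rewrite r0 (leq_trans (ltnW rq)).
    exists (j - (l %/ q)%:Z * k).
    have -> : r%:R * t - (j - (l %/ q)%:Z * k)%:~R = r%:R * xi.
      have lE : l%:R = (l %/ q)%:R * q%:R + r%:R :> R by rewrite -natrM -natrD -divn_eq.
      rewrite intrB intrM -pmulrn /xi.
      have -> : j%:~R = l%:R * k%:~R / q%:R :> R by rewrite e2; field.
      by rewrite lE; field.
    rewrite normrM ger0_norm//; apply: le_trans hxi.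
    by rewrite ler_wpM2r// ler_nat ltnW.
  by move=> /qmin; rewrite leqNgt rq.
have h1 : 1 <= `|l%:R * k%:~R - j%:~R * q%:R| :> R.
  have -> : l%:R * k%:~R - j%:~R * q%:R = (l%:Z * k - j * q%:Z)%:~R :> R.
    by rewrite intrB !intrM.
  by rewrite -intr_norm ler1z -gtz0_ge1 normr_gt0.
have h2 : l%:R * t - j%:~R = (l%:R * k%:~R - j%:~R * q%:R) / q%:R + l%:R * xi.
  by rewrite /xi; field.
rewrite -(ler_pM2l q0) -[X in X * `|_|](gtr0_norm q0) -normrM h2.
have -> : q%:R * (1 / (2 * q%:R)) = 1 / 2 :> R by field.
have -> : q%:R * ((l%:R * k%:~R - j%:~R * q%:R) / q%:R + l%:R * xi) =
  (l%:R * k%:~R - j%:~R * q%:R) - (- (q%:R * (l%:R * xi))) by field.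
apply: le_trans (lerB_dist _ _); rewrite normrN !normrM (gtr0_norm q0) (gtr0_norm l0').
lra.
Qed.

(** Each pair of moduli contributes the sum over the multiples of their lcm, which is at most z^2;
    the approximation error thus enters once per pair, weighted by the coefficients. *)
Lemma ev_sqr_correlation (X : seq (R * nat)) z M t q (D : R[i]) :
  (forall w, w \in X -> (0 < w.2 <= z)%N) ->
  (forall l, (0 < l <= z ^ 2)%N ->
    nc (geom (M %/ l).+1 (l%:R * t) - (q %| l)%:R / l%:R * D) <= 4 / 3 * z%:R ^+ 2) ->
  nc (\sum_(0 <= n < M.+1) (ev X n ^+ 2)%:C%C * expi (t * n%:R) - (twform q X X)%:C%C * D) <=
  4 / 3 * z%:R ^+ 2 * l1norm X ^+ 2.
Proof.
move=> hX hD.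
have E : \sum_(0 <= n < M.+1) (ev X n ^+ 2)%:C%C * expi (t * n%:R) =
  \sum_(w <- X) \sum_(v <- X) (w.1 * v.1)%:C%C *
     geom (M %/ lcmn w.2 v.2).+1 ((lcmn w.2 v.2)%:R * t).
  rewrite (eq_bigr (fun n => \sum_(w <- X) \sum_(v <- X) (w.1 * v.1)%:C%C *
      ((lcmn w.2 v.2 %| n)%:R * expi (t * n%:R)))); last first.
    move=> n _; rewrite /ev expr2 rmorphM /= !rmorph_sum /= !mulr_suml; apply: eq_bigr => w _.
    rewrite mulr_sumr mulr_suml; apply: eq_bigr => v _.
    rewrite !rmorphM !rmorph_nat dvdn_lcm; case: (_ %| _)%N; case: (_ %| _)%N => /=; ring.
  rewrite exchange_big; apply: eq_big_seq => w wX /=.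
  rewrite exchange_big; apply: eq_big_seq => v vX /=.
  rewrite -mulr_sumr; congr (_ * _).
  have l0 : (0 < lcmn w.2 v.2)%N.
    by rewrite lcmn_gt0; have /andP[-> _] := hX _ wX; have /andP[-> _] := hX _ vX.
  transitivity (\sum_(0 <= n < M.+1 | (lcmn w.2 v.2 %| n)%N) expi (t * n%:R)).
    by rewrite [RHS]big_mkcond; apply: eq_bigr => n _; case: ifP => _; rewrite ?mul1r ?mul0r.
  by rewrite sum_dvdn//; apply: eq_bigr => k _; rewrite natrM; congr expi; ring.
have F : (twform q X X)%:C%C * D = \sum_(w <- X) \sum_(v <- X) (w.1 * v.1)%:C%C *
   ((q %| lcmn w.2 v.2)%:R / (lcmn w.2 v.2)%:R * D).
  rewrite /twform !rmorph_sum mulr_suml; apply: eq_bigr => w _ /=.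
  rewrite !rmorph_sum mulr_suml; apply: eq_bigr => v _ /=.
  rewrite [RHS]mulrA; congr (_ * D); set l := lcmn _ _.
  rewrite (rmorphM (real_complex R) (w.1 * v.1)); congr (_ * _).
  by rewrite (rmorphM (real_complex R)) fmorphV !rmorph_nat.
rewrite E F -sumrB; apply: le_trans (normc_sum _ _ _ _) _.
set C0 := 4 / 3 * _ in hD *; rewrite expr2 [leRHS]mulrA {2}/l1norm mulr_sumr.
rewrite big_seq [leRHS]big_seq; apply: ler_sum => w wX.
rewrite -sumrB; apply: le_trans (normc_sum _ _ _ _) _.
rewrite /l1norm mulr_sumr mulr_suml big_seq [leRHS]big_seq; apply: ler_sum => v vX.
rewrite -mulrBr Normc.normcM normc_real normrM.
rewrite (_ : _ * `|v.1| * `|w.1| = `|w.1| * `|v.1| * C0); last by ring.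
rewrite ler_wpM2l ?mulr_ge0//; apply: hD.
have /andP[w0 wz] := hX _ wX; have /andP[v0 vz] := hX _ vX.
rewrite lcmn_gt0 w0 v0 /= (leq_trans (_ : _ <= w.2 * v.2)%N) ?leq_mul//.
by rewrite dvdn_leq ?muln_gt0 ?w0// dvdn_lcm dvdn_mulr ?dvdn_mull.
Qed.

(** If q = 1, subtracting the mean cancels the main term. Otherwise let p be the least prime factor
    of q: outside [Q] the coefficient vanishes, inside [Q] it is O(G / p) by [form_twist_le] after
    moving p to the head. For q > 1 the mean itself correlates little with the exponential (the case
    l = 1), which doubles 4/3 to 8/3. *)
Lemma mass_correlation (y z M : nat) (Q : seq nat) t (B1 : R) :
  (0 < y)%N -> (2 < z)%N -> all prime Q -> uniq Q -> (forall p, p \in Q -> (y < p)%N) ->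
  z%:R * \prod_(p <- Q) (1 + (p%:R^-1 + 2 / (p%:R * (p%:R - 1)))) <= B1 ->
  nc (\sum_(0 <= n < M.+1) (ev (expansion Q z) n ^+ 2 - mass Q z)%:C%C * expi (t * n%:R)) <=
  7 / 6 / y%:R * mass Q z * M.+1%:R + 8 / 3 * z%:R ^+ 2 * B1 ^+ 2.
Proof.
move=> y0 z2 aQ uQ yQ hB.
have y0' : 0 < y%:R :> R by rewrite ltr0n.
have G0 : 0 <= mass Q z :> R by exact: mass_ge0.
have k0 : 0 <= 7 / 6 / y%:R :> R by apply: divr_ge0; lra.
have G1 : 1 <= mass Q z :> R by apply: mass_ge1 => //; lia.
have l1B (Q' : seq nat) : all prime Q' -> perm_eq Q' Q -> l1norm (expansion Q' z : seq (R * nat)) <= B1.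
  by move=> aQ' pQ; apply: le_trans (l1norm_expansion_le _ _ aQ') _; rewrite (perm_big _ pQ).
have GB : mass Q z <= B1 by apply: le_trans (mass_le_l1norm _ _ aQ) (l1B _ aQ (perm_refl _)).
have B2 : mass Q z <= B1 ^+ 2 by nra.
have [q [D [q0 D1 Dq hD]]] := multiples_approx z M t z2.
have Z0 : 0 <= z%:R ^+ 2 :> R by exact: sqr_ge0.
have c0 : 0 <= 4 / 3 * z%:R ^+ 2 :> R by lra.
have split_sum (X : seq (R * nat)) : (forall n, ev X n = ev (expansion Q z) n) ->
   \sum_(0 <= n < M.+1) (ev (expansion Q z) n ^+ 2 - mass Q z)%:C%C * expi (t * n%:R) =
   (\sum_(0 <= n < M.+1) (ev X n ^+ 2)%:C%C * expi (t * n%:R) - (twform q X X)%:C%C * D)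
   + ((twform q X X)%:C%C * D - (mass Q z)%:C%C * geom M.+1 t).
  move=> eX; rewrite addrA subrK /geom mulr_sumr -sumrB; apply: eq_bigr => n _.
  by rewrite eX rmorphB mulrBl.
have final (X : seq (R * nat)) : (forall n, ev X n = ev (expansion Q z) n) ->
    (forall w, w \in X -> (0 < w.2 <= z)%N) -> l1norm X <= B1 ->
    `|twform q X X| <= 7 / 6 / y%:R * mass Q z -> (q != 1%N) ->
    nc (\sum_(0 <= n < M.+1) (ev (expansion Q z) n ^+ 2 - mass Q z)%:C%C * expi (t * n%:R)) <=
    7 / 6 / y%:R * mass Q z * M.+1%:R + 8 / 3 * z%:R ^+ 2 * B1 ^+ 2.
  move=> eX hX lX fX q1; rewrite (split_sum X eX).
  apply: le_trans (normcD _ _) _.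
  have h1 := ev_sqr_correlation X z M t q D hX hD.
  have h1' : 4 / 3 * z%:R ^+ 2 * l1norm X ^+ 2 <= 4 / 3 * z%:R ^+ 2 * B1 ^+ 2.
    by rewrite ler_wpM2l// lerXn2r ?nnegrE ?l1norm_ge0// (le_trans _ lX)// l1norm_ge0.
  have h2 : nc ((twform q X X)%:C%C * D) <= 7 / 6 / y%:R * mass Q z * M.+1%:R.
    by rewrite Normc.normcM normc_real; apply: ler_pM => //; exact: normc_ge0.
  have h3 : nc ((mass Q z)%:C%C * geom M.+1 t) <= 4 / 3 * z%:R ^+ 2 * B1 ^+ 2.
    rewrite Normc.normcM normc_real ger0_norm// mulrC; apply: ler_pM => //; first exact: normc_ge0.
    have := hD 1%N; rewrite dvdn1 (negbTE q1) mul0r mul0r subr0 mul1r divn1; apply.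
    by rewrite /= expn_gt0 (ltn_trans _ z2).
  apply: le_trans (lerD h1 (normcB _ _)) _; lra.
have hE (Q' : seq nat) : all prime Q' ->
    forall w, w \in (expansion Q' z : seq (R * nat)) -> (0 < w.2 <= z)%N.
  by move=> aQ' w; exact: expansion_le.
have [q1|q1] := eqVneq q 1%N.
  rewrite (split_sum (expansion Q z))// q1 form_expansion// Dq// subrr addr0.
  have := ev_sqr_correlation _ z M t q D (hE _ aQ) hD.
  rewrite q1 form_expansion// Dq// => /le_trans; apply.
  have h1 := l1B _ aQ (perm_refl _).
  have h1' : 4 / 3 * z%:R ^+ 2 * l1norm (expansion Q z) ^+ 2 <= 4 / 3 * z%:R ^+ 2 * B1 ^+ 2.
    by rewrite ler_wpM2l// lerXn2r ?nnegrE ?l1norm_ge0// (le_trans _ h1)// l1norm_ge0.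
  apply: le_trans h1' _.
  have := mulr_ge0 (mulr_ge0 k0 G0) (ler0n R M.+1).
  have : 0 <= 4 / 3 * z%:R ^+ 2 * B1 ^+ 2 by rewrite mulr_ge0// sqr_ge0.
  lra.
have pp : prime (pdiv q) by rewrite pdiv_prime//; case: q q0 q1 {hD Dq split_sum final} => [|[|]].
set p := pdiv q in pp.
have qE : q = (p * (q %/ p))%N by rewrite mulnC divnK// pdiv_dvd.
have qp0 : (0 < q %/ p)%N by rewrite divn_gt0 ?pdiv_gt0// pdiv_leq.
have [pQ|pQ] := boolP (p \in Q); last first.
  apply: (final (expansion Q z)) => //; [exact: hE|exact: l1B|].
  by rewrite qE form_free0//; [rewrite normr0 mulr_ge0|exact: expansion_free..].
have pe : perm_eq (p :: rem p Q) Q by rewrite perm_sym perm_to_rem.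
have aQ' : all prime (p :: rem p Q) by rewrite (perm_all _ pe).
have uQ' : uniq (p :: rem p Q) by rewrite (perm_uniq pe).
apply: (final (expansion (p :: rem p Q) z)) => //; [|exact: hE|exact: l1B|].
  by move=> n; rewrite -ev_expansion_rem.
rewrite qE; apply: le_trans (form_twist_le _ _ _ _ aQ' uQ' qp0) _.
rewrite -mass_rem// ler_wpM2r// ler_pM2l//.
rewrite lef_pV2 ?posrE ?prime_sub1_gt0// lerBrDr natr1 ler_nat; exact: yQ.
Qed.

End Correlation.

(** * The sieve bound *)

Section SieveBound.
Context {R : realType}.
Local Notation nc := (@Normc.normc R).

Lemma normc_expsum_le n (u : 'I_n -> R[i]) (x : 'I_n -> R) (t : R) :
  nc (expsum u x t) <= \sum_i nc (u i).
Proof.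
apply: le_trans (normc_sum _ _ _ _) _; apply: ler_sum => i _.
by rewrite Normc.normcM normc_expi mulr1.
Qed.

Lemma sieve_bound n (u : 'I_n -> R[i]) (x : 'I_n -> R) (delta N B1 : R) (M y z : nat)
    (Q := primes_between y.+1 z.+1) :
  0 < delta -> spaced delta x -> 100 <= N -> M%:R <= N -> (0 < y)%N -> (2 < z)%N ->
  z%:R * \prod_(p <- Q) (1 + (p%:R^-1 + 2 / (p%:R * (p%:R - 1)))) <= B1 ->
  \sum_(0 <= p < M.+1 | prime p) nc (expsum u x p%:R) ^+ 2 <=
  z%:R * (\sum_i nc (u i)) ^+ 2 +
  (mass Q z)^-1 * (61 / 50 * (N + delta^-1) * \sum_i nc (u i) ^+ 2) +
  (\sum_i nc (u i)) ^+ 2 *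
   (7 / 6 / y%:R * (N + 1) * (mass Q z)^-1 + 8 / 3 * z%:R ^+ 2 * (B1 / mass Q z) ^+ 2).
Proof.
move=> d0 sep N1 MN y0 z2 hB; set F1 := \sum_i nc (u i); set F2 := \sum_i _ ^+ 2.
have aQ : all prime Q by exact: all_primes_between.
have uQ : uniq Q by exact: uniq_primes_between.
set G : R := mass Q z.
have G1 : 1 <= G by apply: mass_ge1 => //; exact: ltn_trans z2.
have G0 : 0 < G by lra.
have F10 : 0 <= F1 by apply: sumr_ge0 => i _; exact: normc_ge0.
pose S k := nc (expsum u x k%:R) ^+ 2.
have S0 k : 0 <= S k by exact: sqr_ge0.
have SF k : S k <= F1 ^+ 2 by rewrite lerXn2r ?nnegrE ?normc_ge0// normc_expsum_le.
pose h k := ev (expansion Q z : seq (R * nat)) k.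
(* The primes up to z get the trivial bound, since h need not equal G there. *)
have step1 : \sum_(0 <= p < M.+1 | prime p) S p <=
    \sum_(0 <= p < M.+1 | (0 < p <= z)%N) F1 ^+ 2 + G ^- 2 * \sum_(0 <= k < M.+1) h k ^+ 2 * S k.
  rewrite mulr_sumr big_mkcond [X in _ <= X + _]big_mkcond -big_split /=.
  apply: ler_sum_nat => p /andP[_ pM].
  have g0 : 0 <= G ^- 2 * (h p ^+ 2 * S p).
    by rewrite mulr_ge0 ?invr_ge0 ?exprn_ge0 ?(ltW G0)// mulr_ge0// sqr_ge0.
  case: ifP => pp; last by case: ifP => _; rewrite ?add0r// addr_ge0// sqr_ge0.
  rewrite prime_gt0//=; case: leqP => pz; first by rewrite ler_wpDr.
  rewrite add0r /h ev_expansion_prime// -/G; last first.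
    by rewrite mem_primes_between ltnS negb_and negb_and -!ltnNge pz !orbT.
  by rewrite mulrA mulVf ?mul1r// expf_neq0// lt0r_neq0.
have step2 : \sum_(0 <= p < M.+1 | (0 < p <= z)%N) F1 ^+ 2 <= z%:R * F1 ^+ 2.
  rewrite -big_filter big_const_seq count_predT iter_addr_0 -[leLHS]mulr_natl ler_wpM2r ?sqr_ge0//.
  rewrite ler_nat -[leqRHS](size_iota 1) uniq_leq_size ?filter_uniq ?iota_uniq// => k.
  by rewrite mem_filter mem_iota add1n ltnS => /andP[].
have step3 : \sum_(0 <= k < M.+1) h k ^+ 2 * S k =
    G * \sum_(0 <= k < M.+1) S k + \sum_(0 <= k < M.+1) (h k ^+ 2 - G) * S k.
  by rewrite mulr_sumr -big_split; apply: eq_bigr => k _ /=; ring.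
have step4 : \sum_(0 <= k < M.+1) S k <= 61 / 50 * (N + delta^-1) * F2.
  exact: large_sieve_uniform.
(* All pairs, the diagonal included, get the same correlation bound, so their sum costs
   [F1 ^+ 2]. *)
have step5 : \sum_(0 <= k < M.+1) (h k ^+ 2 - G) * S k <=
    F1 ^+ 2 * (7 / 6 / y%:R * G * M.+1%:R + 8 / 3 * z%:R ^+ 2 * B1 ^+ 2).
  apply: le_trans (@quadratic_form_le R n u x _ _ (fun k => h k ^+ 2 - G) (fun k => k%:R)) _.
  rewrite expr2 -mulrA [leRHS]mulr_suml; apply: ler_sum => i _.
  rewrite mulr_suml mulr_sumr; apply: ler_sum => j _.
  rewrite -mulrA; apply: ler_wpM2l; first exact: normc_ge0.
  apply: ler_wpM2l; first exact: normc_ge0.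
  apply: mass_correlation => // p; rewrite mem_primes_between => /and3P[].
  by [].
apply: le_trans step1 _; rewrite -addrA lerD//.
have iG2 : 0 < G ^- 2 by rewrite invr_gt0 exprn_gt0.
rewrite step3; apply: le_trans (_ : G ^- 2 * (G * (61 / 50 * (N + delta^-1) * F2) +
    F1 ^+ 2 * (7 / 6 / y%:R * G * (N + 1) + 8 / 3 * z%:R ^+ 2 * B1 ^+ 2)) <= _).
  rewrite ler_pM2l// lerD//; first by rewrite ler_pM2l.
  apply: le_trans step5 _; rewrite ler_wpM2l ?sqr_ge0// lerD2r ler_wpM2l//.
    by rewrite mulr_ge0 ?(ltW G0)// divr_ge0//; lra.
  by rewrite -natr1 lerD2r.
rewrite le_eqVlt; apply/orP; left; apply/eqP; field.
by rewrite !lt0r_neq0 ?ltr0n.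
Qed.

(** * Explicit bounds for logarithms, exponentials and Euler products *)

Lemma is_derive_ln_ratio (c s : R) : 0 <= s < 1 ->
  is_derive s 1 (fun s : R => ln (1 + s) - ln (1 - s) - (2 * s + c * s ^+ 3))
   (2 / (1 - s ^+ 2) - (2 + 3 * c * s ^+ 2)).
Proof.
move=> /andP[s0 s1].
have d1 : is_derive s 1 (fun s : R => ln (1 + s)) ((1 + s)^-1).
  rewrite -[X in is_derive _ _ _ X]mulr1.
  apply: (@is_derive1_comp R (@ln R) (fun s => 1 + s) s); first by apply: is_derive1_ln; lra.
  by rewrite -[X in is_derive _ _ _ X]add0r; apply: is_deriveD.
have d2 : is_derive s 1 (fun s : R => ln (1 - s)) (- (1 - s)^-1).
  rewrite -mulrN1.
  apply: (@is_derive1_comp R (@ln R) (fun s => 1 - s) s); first by apply: is_derive1_ln; lra.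
  by rewrite -[X in is_derive _ _ _ X]add0r; apply: is_deriveB.
have d3 : is_derive s 1 (fun s : R => 2 * s + c * s ^+ 3) (2 + 3 * c * s ^+ 2).
  apply: is_derive_eq; rewrite /GRing.scale /=; ring.
rewrite (_ : 2 / _ - _ = (1 + s)^-1 - - (1 - s)^-1 - (2 + 3 * c * s ^+ 2)); last first.
  by field; apply/and3P; split; apply: lt0r_neq0; nra.
exact: (is_deriveB (is_deriveB d1 d2) d3).
Qed.

Lemma ln_ratio_ge (t : R) : 0 <= t < 1 -> 2 * t + 2 / 3 * t ^+ 3 <= ln (1 + t) - ln (1 - t).
Proof.
move=> /andP[t0 t1]; rewrite -subr_ge0.
have dr := is_derive_ln_ratio (2 / 3).
pose f (s : R) := ln (1 + s) - ln (1 - s) - (2 * s + 2 / 3 * s ^+ 3).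
have : f 0 <= f t; last by rewrite /f addr0 subr0 subrr mulr0 expr0n mulr0 addr0 subr0.
have hs s : s \in `]0, t[ -> 0 <= s < 1 by rewrite in_itv /=; lra.
apply: (@ger0_derive1_ndecr R f 0 t) => //.
- by move=> s /hs s01; exact: (@ex_derive _ _ _ _ _ _ _ (dr s s01)).
- move=> s /hs s01; rewrite derive1E (@derive_val _ _ _ _ _ _ _ (dr s s01)).
  have s2 : 0 < 1 - s ^+ 2 by nra.
  have -> : 2 / (1 - s ^+ 2) - (2 + 3 * (2 / 3) * s ^+ 2) = 2 * s ^+ 4 / (1 - s ^+ 2).
    by field; apply: lt0r_neq0.
  by rewrite divr_ge0 ?(ltW s2)// mulr_ge0// exprn_even_ge0.
- apply: derivable_within_continuous => s; rewrite in_itv /= => s01.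
  by apply: (@ex_derive _ _ _ _ _ _ _ (dr s _)); lra.
Qed.

(** With 3/4 in place of the Taylor coefficient 2/3, the derivative of the difference changes sign
    exactly at 1/3. *)
Lemma ln_ratio_le (t : R) : 0 <= t <= 1 / 3 -> ln (1 + t) - ln (1 - t) <= 2 * t + 3 / 4 * t ^+ 3.
Proof.
move=> /andP[t0 t1]; rewrite -subr_le0.
have dr := is_derive_ln_ratio (3 / 4).
pose f (s : R) := ln (1 + s) - ln (1 - s) - (2 * s + 3 / 4 * s ^+ 3).
have : f t <= f 0; last by rewrite /f addr0 subr0 subrr mulr0 expr0n mulr0 addr0 subr0.
have hs s : s \in `]0, t[ -> 0 <= s < 1 / 3 by rewrite in_itv /=; lra.
have hs1 (s : R) : 0 <= s < 1 / 3 -> 0 <= s < 1 by lra.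
apply: (@ler0_derive1_nincr R f 0 t) => //.
- by move=> s /hs/hs1 s01; exact: (@ex_derive _ _ _ _ _ _ _ (dr s s01)).
- move=> s /hs s01; rewrite derive1E (@derive_val _ _ _ _ _ _ _ (dr s (hs1 s s01))).
  have s2 : 0 < 1 - s ^+ 2 by nra.
  have -> : 2 / (1 - s ^+ 2) - (2 + 3 * (3 / 4) * s ^+ 2) =
     - (s ^+ 2 * (1 / 9 - s ^+ 2) * (9 / 4)) / (1 - s ^+ 2).
    by field; apply: lt0r_neq0.
  rewrite mulNr oppr_le0 divr_ge0 ?(ltW s2)// mulr_ge0//.
  by rewrite mulr_ge0 ?sqr_ge0//; nra.
- apply: derivable_within_continuous => s; rewrite in_itv /= => s01.
  by apply: (@ex_derive _ _ _ _ _ _ _ (dr s _)); lra.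
Qed.

Lemma ln_bounds (x t : R) : 0 <= t <= 1 / 3 -> x * (1 - t) = 1 + t ->
  2 * t + 2 / 3 * t ^+ 3 <= ln x <= 2 * t + 3 / 4 * t ^+ 3.
Proof.
move=> t01 xt.
have -> : x = (1 + t) / (1 - t) by rewrite -xt mulfK// lt0r_neq0//; lra.
by rewrite ln_div ?posrE; [rewrite ln_ratio_ge ?ln_ratio_le//; lra|lra..].
Qed.

Lemma ln2_bounds : 97 / 140 <= ln (2 : R) <= 25 / 36.
Proof.
have -> : ln 2 = ln (3 / 2) + ln (4 / 3) :> R by rewrite -lnM ?posrE; [congr ln; lra|lra..].
have := ln_bounds (3 / 2) (1 / 5); have := ln_bounds (4 / 3) (1 / 7); lra.
Qed.

(** exp(x / k) <= 1 / (1 - x / k), raised to the power k; a larger k sharpens the bound. *)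
Lemma expR_le_pow (x r : R) (k : nat) : (0 < k)%N -> 0 < r -> 1 <= r * (1 - x / k%:R) -> expR x <= r ^+ k.
Proof.
move=> k0 r0 h; have k0' : k%:R != 0 :> R by rewrite pnatr_eq0 -lt0n.
have -> : x = k%:R * (x / k%:R) by rewrite mulrC divfK.
rewrite expRM_natl lerXn2r ?nnegrE ?(ltW r0) ?(ltW (expR_gt0 _))//.
rewrite -[expR _]invrK -expRN -[leRHS]invrK lef_pV2 ?posrE ?invr_gt0 ?expR_gt0//.
apply: le_trans (expR_ge1Dx _); rewrite -[leLHS]mul1r ler_pdivrMr// mulrC; exact: h.
Qed.

Lemma ln_256_ge : 97 / 140 * 8 <= ln (256 : R).
Proof.
have -> : 256 = 2 ^+ 8 :> R by lra.
by rewrite lnXn// -[ln 2 *+ 8]mulr_natr; have /andP[] := ln2_bounds; lra.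
Qed.

Lemma mertens_exponent_le (y : nat) (j : R) : (256 <= y)%N -> 0 <= j ->
  (ln 4 + (1 + ln y%:R) / y%:R) / ln y%:R + j / y%:R <= 512 / 2000 + j / 256 :> R.
Proof.
move=> y256 j0; have yR : 256 <= y%:R :> R by rewrite (ler_nat R 256).
have y0 : 0 < y%:R :> R by lra.
have /andP[l2 l2'] := ln2_bounds.
have l256 : 97 / 140 * 8 <= ln y%:R :> R.
  by apply: le_trans ln_256_ge _; rewrite ler_ln ?posrE.
have l4 : ln 4 <= 25 / 18 :> R.
  have -> : 4 = 2 ^+ 2 :> R by lra.
  by rewrite lnXn// -[ln 2 *+ 2]mulr_natr; lra.
rewrite lerD//; last by rewrite ler_wpM2l// lef_pV2 ?posrE.
move: (ln y%:R) l256 => l l256; have l0 : 0 < l by lra.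
rewrite ler_pdivrMr//.
have : (1 + l) / y%:R <= (1 + l) / 256 by rewrite ler_wpM2l ?lef_pV2 ?posrE//; lra.
lra.
Qed.

(** The computed product up to 256, then [prod_prime_le] with j = 1. The explicit Mertens error
    raises e^gamma = 1.78... to 47/20. *)
Lemma prod_prime_sub1_le (y : nat) : (256 <= y)%N ->
  \prod_(0 <= p < y.+1 | prime p) (p%:R / (p%:R - 1)) <= 47 / 20 * ln y%:R :> R.
Proof.
move=> y256; rewrite (big_cat_nat (n := 257)) //.
have l256 := ln_256_ge.
have ly : 0 <= ln y%:R :> R by apply: ln_ge0; rewrite ler1n (leq_trans _ y256).
have h1 := @prod_prime_sub1_256 R.
have h2 : \prod_(257 <= p < y.+1 | prime p) (p%:R / (p%:R - 1)) <=
    ln y%:R / ln 256 * (61 / 60) ^+ 16 :> R.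
  apply: le_trans (@prod_prime_le R 1 _ 256 y _ y256 _ _) _ => //.
    move=> p p256 pp; have p1 : 0 < p%:R - 1 :> R by exact: prime_sub1_gt0.
    have p0 : 0 < p%:R :> R by lra.
    rewrite divr_ge0 ?(ltW p0) ?(ltW p1)//= le_eqVlt; apply/orP; left; apply/eqP.
    by field; rewrite !lt0r_neq0.
  rewrite ler_wpM2l ?divr_ge0//; first lra.
  apply: le_trans (_ : expR (512 / 2000 + 1 / 256) <= _).
    by rewrite ler_expR; exact: mertens_exponent_le.
  by apply: expR_le_pow => //; lra.
have P0 : 0 <= \prod_(257 <= p < y.+1 | prime p) (p%:R / (p%:R - 1)) :> R.
  by apply: prodr_ge0 => p pp; apply: divr_ge0; [exact: ler0n|exact/ltW/prime_sub1_gt0].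
move: h1 h2 P0 l256 ly.
move: (\prod_(0 <= p < 257 | prime p) (p%:R / (p%:R - 1) : R)).
move: (\prod_(257 <= p < y.+1 | prime p) (p%:R / (p%:R - 1) : R)).
move: (ln y%:R : R) (ln 256 : R) => l m b a h1 h2 b0 m0 l0.
apply: le_trans (ler_wpM2r b0 h1) _.
have m0' : 0 < m by lra.
have h3 : m * b <= l * (61 / 60) ^+ 16.
  by move: h2; rewrite mulrAC ler_pdivlMr// mulrC.
have h4 : (61 / 60) ^+ 16 * (997 / 100) <= 47 / 20 * (97 / 140 * 8) :> R by lra.
rewrite -(ler_pM2l m0') mulrCA.
apply: le_trans (ler_wpM2l _ h3) _; first lra.
apply: le_trans (_ : l * (47 / 20 * (97 / 140 * 8)) <= _).
  by rewrite mulrCA ler_wpM2l// mulrC.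
by have := ler_wpM2l l0 m0; lra.
Qed.

(** Here [g] is 1 / G, and 100/21 comes from ln z being about 21/100 ln N. The two terms without N
    are each a multiple of K z^4 [F2], in total 1 + 8/3 (308/100)^2 < 28. *)
Lemma sieve_arithmetic (T z F1 F2 g N D y B1 K Pv nu eps : R) :
  T <= z * F1 ^+ 2 + g * (61 / 50 * (N + D) * F2) +
    F1 ^+ 2 * (7 / 6 / y * (N + 1) * g + 8 / 3 * z ^+ 2 * (B1 * g) ^+ 2) ->
  F1 ^+ 2 = K * F2 -> 0 <= F2 -> 0 < N -> 0 < D -> 0 < y -> 0 <= K -> 0 < nu -> 1 <= z ->
  0 <= eps -> 0 <= g -> nu * g <= 100 / 21 * Pv -> 0 <= B1 * g -> B1 * g <= 308 / 100 * z ->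
  28 * (K * z ^+ 4 * nu) <= eps * N ->
  T * nu <= (eps + 100 / 21 * Pv * (61 / 50 + 7 / 6 * (K / y) * (1 + N^-1))) * (N + D) * F2.
Proof.
move=> hT FK F20 N0 D0 y0 K0 nu0 z1 eps0 g0 hg B0 hB herr.
rewrite FK in hT.
have hB2 : (B1 * g) ^+ 2 <= (308 / 100 * z) ^+ 2 by rewrite lerXn2r ?nnegrE// (le_trans B0).
have z4 : z <= z ^+ 4 by rewrite -[leLHS]expr1 ler_weXn2l.
set W := 100 / 21 * Pv in hg *.
set A := 7 / 6 / y * (N + 1).
have A0 : 0 <= A by rewrite mulr_ge0 ?divr_ge0//; lra.
have hA : A * K <= 7 / 6 * (K / y) * (1 + N^-1) * (N + D).
  have -> : A * K = 7 / 6 * (K / y) * (1 + N^-1) * N by rewrite /A; field; rewrite !lt0r_neq0.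
  rewrite ler_wpM2l//; last lra.
  by rewrite !mulr_ge0 ?divr_ge0 ?addr_ge0 ?invr_ge0 ?(ltW y0) ?(ltW N0).
have s1 : T * nu <= K * F2 * (z * nu) + nu * g * (61 / 50 * (N + D) * F2) +
    K * F2 * (A * (nu * g)) + K * F2 * (8 / 3 * z ^+ 2 * (308 / 100 * z) ^+ 2 * nu).
  apply: le_trans (_ : (z * (K * F2) + g * (61 / 50 * (N + D) * F2) +
    K * F2 * (A * g + 8 / 3 * z ^+ 2 * (308 / 100 * z) ^+ 2)) * nu <= _).
    rewrite ler_pM2r//; apply: le_trans hT _; rewrite lerD2l ler_wpM2l ?mulr_ge0// lerD2l.
    by rewrite ler_wpM2l// mulr_ge0// sqr_ge0.
  by rewrite le_eqVlt; apply/orP; left; apply/eqP; ring.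
have W0 : nu * g * (61 / 50 * (N + D) * F2) <= W * (61 / 50 * (N + D) * F2).
  by rewrite ler_wpM2r// !mulr_ge0//; lra.
have W1 : K * F2 * (A * (nu * g)) <= K * F2 * (A * W).
  by rewrite ler_wpM2l ?mulr_ge0// ler_wpM2l.
have KF : 0 <= K * F2 by rewrite mulr_ge0.
have E1 : K * F2 * (z * nu) <= K * F2 * (z ^+ 4 * nu).
  by rewrite ler_wpM2l// ler_wpM2r// ltW.
have z40 : 0 <= K * F2 * (z ^+ 4 * nu).
  apply: mulr_ge0 => //; apply: mulr_ge0; last exact: ltW.
  by apply: exprn_ge0; apply: le_trans z1.
have E2 : 28 * (K * F2 * (z ^+ 4 * nu)) <= eps * (N + D) * F2.
  have -> : 28 * (K * F2 * (z ^+ 4 * nu)) = 28 * (K * z ^+ 4 * nu) * F2 by ring.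
  by rewrite ler_wpM2r//; apply: le_trans herr _; rewrite ler_wpM2l//; lra.
apply: le_trans s1 _.
have -> : K * F2 * (8 / 3 * z ^+ 2 * (308 / 100 * z) ^+ 2 * nu) =
   (8 / 3 * (308 / 100) ^+ 2) * (K * F2 * (z ^+ 4 * nu)) by field.
have W00 : 0 <= W by apply: le_trans hg; rewrite mulr_ge0// ltW.
have W2 : K * F2 * (A * W) <= W * (7 / 6 * (K / y) * (1 + N^-1) * (N + D)) * F2.
  have -> : K * F2 * (A * W) = W * (A * K) * F2 by ring.
  by rewrite ler_wpM2r// ler_wpM2l.
have -> : (eps + W * (61 / 50 + 7 / 6 * (K / y) * (1 + N^-1))) * (N + D) * F2 =
  eps * (N + D) * F2 + W * (61 / 50 * (N + D) * F2) +
  W * (7 / 6 * (K / y) * (1 + N^-1) * (N + D)) * F2 by ring.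
have sum4 (a1 a2 a3 a4 b1 b2 b3 : R) : a1 <= a4 -> a2 <= b2 -> a3 <= b3 -> 0 <= a4 ->
    28 * a4 <= b1 -> a1 + a2 + a3 + 8 / 3 * (308 / 100) ^+ 2 * a4 <= b1 + b2 + b3.
  by clear; lra.
exact: (sum4 _ _ _ _ _ _ _ E1 W0 (le_trans W1 W2) z40 E2).
Qed.

(* With [N > (2 K)^(950/61)] and [z <= N^(21/100)] the error terms of [sieve_bound]
   are governed by [K z^4 / N <= N^(- 91/950) / 2]. *)
Lemma sieve_level (K N : R) (y : nat) (nu := ln N) :
  100 <= N -> 24 <= K -> 19 * ln (2 * K) <= 61 / 50 * nu -> y%:R <= (2 * K) ^+ 2 ->
  exists2 z : nat, (y <= z)%N &
    ln z%:R <= 21 / 100 * nu <= ln z.+1%:R /\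
    (2 * (K * z%:R ^+ 4)) * expR (91 / 950 * nu) <= N.
Proof.
move=> N4 K24 KN yK; have N0 : 0 < N by lra.
have NE : N = expR nu by rewrite lnK ?posrE.
have K0 : 0 < 2 * K by lra.
have nu0 : 0 < nu by apply: ln_gt0; lra.
have [e eE] : {e : R | e = expR (21 / 100 * nu)} by exists (expR (21 / 100 * nu)).
have e0 : 0 < e by rewrite eE expR_gt0.
have [z z1 z2] : exists2 z : nat, z%:R <= e & e < z.+1%:R.
  by exists (Num.truncn e); have /andP[] := truncn_itv (ltW e0).
have KL : 2 * K <= expR (61 / 950 * nu).
  by rewrite -[leLHS]lnK ?posrE// ler_expR; lra.
have ze : e < z%:R + 1 by rewrite natr1.
exists z.
  rewrite -ltnS -(ltr_nat R); apply: le_lt_trans z2; apply: le_trans yK _.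
  apply: le_trans (_ : expR (61 / 950 * nu) ^+ 2 <= _).
    by apply: lerXn2r; rewrite ?nnegrE ?(ltW K0) ?(ltW (expR_gt0 _)).
  by rewrite -expRM_natl eE ler_expR; lra.
split; last first.
  apply: le_trans (_ : expR (61 / 950 * nu) * e ^+ 4 * expR (91 / 950 * nu) <= _).
    rewrite ler_wpM2r ?(ltW (expR_gt0 _))// mulrA ler_pM ?(ltW K0) ?exprn_ge0//.
    by rewrite lerXn2r ?nnegrE ?(ltW e0).
  by rewrite NE eE -expRM_natl -!expRD ler_expR; lra.
apply/andP; split.
  have [->|z0] := posnP z; first by rewrite ln0//; lra.
  by rewrite -[leRHS]expRK -eE ler_ln ?posrE ?ltr0n.
by rewrite -[leLHS]expRK -eE ler_ln ?posrE ?ltr0n// (ltW z2).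
Qed.

(** [Pv] stays a parameter so that the computed product can be used at y = 256 and the Mertens bound
    for larger y. *)
Lemma sieve_bound_ln n (u : 'I_n -> R[i]) (x : 'I_n -> R) (delta N K Pv eps : R) (M y : nat)
    (F1 := \sum_i nc (u i)) (F2 := \sum_i nc (u i) ^+ 2) :
  0 < delta -> spaced delta x -> 100 <= N -> M%:R <= N ->
  24 <= K -> F1 ^+ 2 = K * F2 -> 19 * ln (2 * K) <= 61 / 50 * ln N ->
  (256 <= y)%N -> y%:R <= (2 * K) ^+ 2 ->
  \prod_(0 <= p < y.+1 | prime p) (p%:R / (p%:R - 1)) <= Pv -> Pv <= 47 / 20 * ln y%:R ->
  0 <= eps -> 14 * ln N <= eps * expR (91 / 950 * ln N) ->
  (\sum_(0 <= p < M.+1 | prime p) nc (expsum u x p%:R) ^+ 2) * ln N <=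
  (eps + 100 / 21 * Pv * (61 / 50 + 7 / 6 * (K / y%:R) * (1 + N^-1))) * (N + delta^-1) * F2.
Proof.
move=> d0 sep N4 MN K24 FK KN y256 yK hP PC eps0 heps.
have [z yz [/andP[lz lz1] hz]] := sieve_level K N y N4 K24 KN yK.
set nu := ln N in KN heps lz lz1 hz *.
have N0 : 0 < N by lra.
have D0 : 0 < delta^-1 by rewrite invr_gt0.
have F20 : 0 <= F2 by apply: sumr_ge0 => i _; exact: sqr_ge0.
have nu0 : 0 < nu by apply: ln_gt0; lra.
have z256 : (256 <= z)%N by exact: leq_trans yz.
have z0 : 1 <= z%:R :> R by rewrite ler1n (leq_trans _ z256).
have y0n : (0 < y)%N by exact: leq_trans y256.
have y0 : 0 < y%:R :> R by rewrite ltr0n.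
have ly0 : 0 < ln y%:R :> R by apply: ln_gt0; rewrite ltr1n (leq_trans _ y256).
set Q := primes_between y.+1 z.+1.
set G : R := mass Q z.
have G1 : 1 <= G by apply: mass_ge1; [exact: all_primes_between|exact: leq_trans z256].
have G0 : 0 < G := lt_le_trans ltr01 G1.
have PG : 21 / 100 * nu <= Pv * G.
  apply: le_trans lz1 _; apply: le_trans (mass_ge y z yz) _.
  by apply: ler_wpM2r hP; exact: ltW.
pose B1 : R := z%:R * (ln z%:R / ln y%:R * (131 / 100)).
have hB1 : z%:R * \prod_(p <- Q) (1 + (p%:R^-1 + 2 / (p%:R * (p%:R - 1)))) <= B1.
  apply: ler_wpM2l; first exact: ler0n.
  rewrite /Q big_filter.
  apply: le_trans (@prod_prime_le R 2 _ y z _ yz _ _) _; [exact: leq_trans y256|exact: ler0n| |].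
    move=> p yp pp; rewrite lexx andbT.
    have p1 : 0 < p%:R - 1 :> R by exact: prime_sub1_gt0.
    have p0 : 0 < p%:R :> R by rewrite ltr0n prime_gt0.
    by rewrite addr_ge0 ?ler01// addr_ge0 ?invr_ge0 ?(ltW p0)// divr_ge0//; apply: mulr_ge0; exact: ltW.
  apply: ler_wpM2l; first by apply: divr_ge0; [exact: ln_nat_ge0|exact: ltW].
  apply: le_trans (_ : expR (512 / 2000 + 2 / 256) <= _).
    by rewrite ler_expR; apply: mertens_exponent_le.
  apply: le_trans (_ : (60 / 59) ^+ 16 <= _).
    by apply: expR_le_pow => //; lra.
  lra.
(* The factor ln z / ln y in [B1] cancels against the lower bound for G, leaving 131/100 * 47/20 <
   308/100. *)
have hB2 : B1 / G <= 308 / 100 * z%:R.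
  rewrite ler_pdivrMr// /B1 -(ler_pM2r ly0).
  have -> : z%:R * (ln z%:R / ln y%:R * (131 / 100)) * ln y%:R = z%:R * (131 / 100 * ln z%:R) :> R.
    by field; rewrite lt0r_neq0.
  have -> : 308 / 100 * z%:R * G * ln y%:R = z%:R * (308 / 100 * (G * ln y%:R)) by ring.
  apply: ler_wpM2l; first exact: ler0n.
  have : Pv * G <= 47 / 20 * ln y%:R * G by rewrite ler_pM2r.
  have : 0 < G * ln y%:R by rewrite mulr_gt0.
  move: (ln z%:R) (ln y%:R) PG lz => a b PG lz h1 h2; lra.
apply: (@sieve_arithmetic _ z%:R F1 F2 G^-1 N delta^-1 y%:R B1 K Pv nu eps) => //.
- apply: sieve_bound => //; exact: leq_trans z256.
- lra.
- by rewrite invr_ge0 ltW.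
- rewrite ler_pdivrMr//; lra.
- apply: divr_ge0; last exact: ltW.
  rewrite /B1 mulr_ge0 ?ler0n// mulr_ge0//.
  by apply: divr_ge0; [exact: ln_nat_ge0|exact: ltW].
have KZ : 0 <= K * z%:R ^+ 4 by rewrite mulr_ge0 ?exprn_ge0//; lra.
apply: le_trans (_ : 2 * (K * z%:R ^+ 4) * (eps * expR (91 / 950 * nu)) <= _).
  have -> : 28 * (K * z%:R ^+ 4 * nu) = 2 * (K * z%:R ^+ 4) * (14 * nu) by ring.
  by apply: ler_wpM2l => //; rewrite mulr_ge0.
by rewrite mulrCA; apply: ler_wpM2l.
Qed.

End SieveBound.

(** * Numerical inequalities and the theorem for finitely many real points *)

Section FiniteVersion.
Context {R : realType}.
Local Notation nc := (@Normc.normc R).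

(** The tangent at [X], compared with a nearby power of 2, reduces logarithms to rational
    arithmetic. *)
Lemma ln_ge_pow2 (X : R) (k : nat) : 0 < X -> k%:R * (97 / 140) - (2 ^+ k - X) / X <= ln X.
Proof.
move=> X0; have p0 : 0 < 2 ^+ k :> R by rewrite exprn_gt0.
have := le_ln_Bln X (2 ^+ k) X0 p0; rewrite lnXn// -[_ *+ k]mulr_natl.
have /andP[l2 _] := @ln2_bounds R.
have : k%:R * (97 / 140) <= k%:R * ln 2 :> R by rewrite ler_wpM2l.
move: (k%:R * _) (k%:R * _) (ln X) ((_ - _) / X) => a b c d; clear; lra.
Qed.

Lemma ln_mono_pow2 (X Y : R) (k : nat) : 0 < X -> X <= Y ->
  k%:R * (97 / 140) - (2 ^+ k - X) / X <= ln Y.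
Proof.
move=> X0 XY; apply: le_trans (ln_ge_pow2 X k X0) _.
by rewrite ler_ln ?posrE// (lt_le_trans X0).
Qed.

Lemma ln_5_4 : ln (5 / 4) <= 9 / 40 :> R.
Proof. by have := ln_bounds (5 / 4 : R) (1 / 9); lra. Qed.

Lemma expR_ge_pow2 (s : R) (k : nat) : 2 ^+ k * (1 + (s - k%:R * ln 2)) <= expR s.
Proof.
have -> : expR s = 2 ^+ k * expR (s - k%:R * ln 2).
  rewrite -{1}[2 : R]lnK ?posrE// -expRM_natl -expRD; congr expR; ring.
by rewrite ler_wpM2l ?exprn_ge0// expR_ge1Dx.
Qed.

Lemma sieve_numeric_small (K Ni : R) : 24 <= K -> K <= 250 -> 0 <= Ni -> Ni <= 1 / 100 ->
  3 + 100 / 21 * (997 / 100) * (61 / 50 + 7 / 6 * (K / 256) * (1 + Ni)) <= 19 * ln (2 * K).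
Proof.
move=> K24 K250 N0 N1.
have h : K * Ni <= K / 100 by rewrite ler_wpM2l//; lra.
suff : 60 + 95 / 100 + 219 / 1000 * K <= 19 * ln (2 * K).
  by move: h K24; clear; move: (ln _) => l; lra.
(* On each piece the linear side is taken at the right end and the logarithm at the left end; the
   pieces are short enough to afford this. *)
have step (X Z : R) k : 0 < X -> X <= 2 * K -> 2 * K <= Z ->
   60 + 95 / 100 + 219 / 1000 * (Z / 2) <= 19 * (k%:R * (97 / 140) - (2 ^+ k - X) / X) ->
   60 + 95 / 100 + 219 / 1000 * K <= 19 * ln (2 * K).
  move=> X0 XK KZ hh; have := ln_mono_pow2 X (2 * K) k X0 XK.
  by move: (_ - _ / X) (ln _) hh => a l; move: KZ; clear; lra.
clear h N0 N1 Ni.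
have [h1|h1] := leP (2 * K) 80; first by apply: (step 48 80 5); lra.
have [h2|h2] := leP (2 * K) 160; first by apply: (step 80 160 6); lra.
have [h3|h3] := leP (2 * K) 240; first by apply: (step 160 240 7); lra.
have [h4|h4] := leP (2 * K) 360; first by apply: (step 240 360 8); lra.
have [h5|h5] := leP (2 * K) 440; first by apply: (step 360 440 8); lra.
have [h6|h6] := leP (2 * K) 470; first by apply: (step 440 470 9); lra.
by apply: (step 470 500 9); lra.
Qed.

(** 25/9 bounds 2 ln 4 and 187/2000 pays for the square root in [prime_count_le]. The inequality
    fails by K = 27, so the sieve takes over at 24. *)
Lemma chebyshev_numeric (K : R) : 1 <= K -> K <= 24 -> (25 / 9 + 187 / 2000) * K <= 19 * ln (2 * K).
Proof.
move=> K1 K24.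
have step (X Z : R) k : 0 < X -> X <= 2 * K -> 2 * K <= Z ->
   (25 / 9 + 187 / 2000) * (Z / 2) <= 19 * (k%:R * (97 / 140) - (2 ^+ k - X) / X) ->
   (25 / 9 + 187 / 2000) * K <= 19 * ln (2 * K).
  move=> X0 XK KZ hh; have := ln_mono_pow2 X (2 * K) k X0 XK.
  by move: (_ - _ / X) (ln _) hh => a l; move: KZ; clear; lra.
have [h1|h1] := leP (2 * K) 8; first by apply: (step 2 8 1); lra.
have [h2|h2] := leP (2 * K) 24; first by apply: (step 8 24 3); lra.
have [h3|h3] := leP (2 * K) 40; first by apply: (step 24 40 4); lra.
by apply: (step 40 48 5); lra.
Qed.

(** The tangent of ln at 100, applied to sqrt N. *)
Lemma ln_le_sqrt (N : R) : 10 ^+ 4 <= N -> ln N <= 187 / 2000 * Num.sqrt N.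
Proof.
move=> N4; have N0 : 0 < N by apply: lt_le_trans N4; rewrite exprn_gt0.
have s0 : 0 < Num.sqrt N by rewrite sqrtr_gt0.
have s100 : 100 <= Num.sqrt N.
  have -> : 100 = Num.sqrt (10 ^+ 4) :> R.
    have -> : 10 ^+ 4 = 100 ^+ 2 :> R by ring.
    by rewrite sqrtr_sqr ger0_norm.
  by rewrite ler_wsqrtr.
have h1 : ln (Num.sqrt N) - ln 100 <= (Num.sqrt N - 100) / 100 by apply: le_ln_Bln.
have lnE : ln N = 2 * ln (Num.sqrt N).
  by rewrite -{1}(sqr_sqrtr (ltW N0)) lnXn// -[_ *+ 2]mulr_natl.
have l100 : ln 100 = 6 * ln 2 + 2 * ln (5 / 4) :> R.
  have -> : 100 = 2 ^+ 6 * (5 / 4) ^+ 2 :> R by lra.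
  by rewrite lnM ?posrE ?exprn_gt0// !lnXn// ?divr_gt0// !mulr_natl.
have h2 := ln_5_4; have /andP[_ h3] := @ln2_bounds R.
rewrite l100 in h1; rewrite lnE.
move: s100 h3 h2 h1; move: (@ln R 2) (@ln R (5 / 4)) (@ln R _) (Num.sqrt N) => a b c s; clear; lra.
Qed.

(** The hypotheses force nu to be at least about 59, where the tangent of exp at 8 ln 2 already
    beats the linear term. *)
Lemma eps_small (L nu : R) : 19 * L <= 61 / 50 * nu -> 5 * (97 / 140) + 1 / 3 <= L ->
  14 * nu <= 3 * expR (91 / 950 * nu).
Proof.
move=> h1 h2; have := expR_ge_pow2 (91 / 950 * nu) 8; have /andP[_] := @ln2_bounds R.
move: (@ln R 2) (expR _) => l e; lra.
Qed.

Lemma eps_large (L nu : R) : 19 * L <= 61 / 50 * nu -> 6 <= L ->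
  14 * nu <= 1 * expR (91 / 950 * nu).
Proof.
move=> h1 h2; have := expR_ge_pow2 (91 / 950 * nu) 12; have /andP[_] := @ln2_bounds R.
have -> : 2 ^+ 12 = 64 * 64 :> R by ring.
move: (@ln R 2) (expR _) => l e; lra.
Qed.

(** For y near 5 K the coefficient of ln (5 K) is about 16.3. The margin of 2.7 ln (2 K), with ln (2
    K) >= 6, pays for the 1 and for ln (5/2). *)
Lemma sieve_numeric_large (K Ni y ly : R) : 250 <= K -> 0 <= Ni -> Ni <= 1 / 100 ->
  5 * K <= y + 1 -> 0 <= ly -> ly <= ln (5 * K) ->
  1 + 100 / 21 * (47 / 20 * ly) * (61 / 50 + 7 / 6 * (K / y) * (1 + Ni)) <= 19 * ln (2 * K).
Proof.
move=> K250 N0 N1 Ky ly0 hly.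
have y0 : 0 < y by lra.
have l5 : ln (5 * K) = ln (2 * K) + ln 2 + ln (5 / 4).
  by rewrite -!lnM ?posrE; [congr ln; lra|lra..].
have l54 := ln_5_4; have /andP[_ l2] := @ln2_bounds R.
have L6 : 6 <= ln (2 * K).
  by apply: le_trans (ln_mono_pow2 500 (2 * K) 9 _ _); lra.
have Ky' : K / y <= 201 / 1000 by rewrite ler_pdivrMr//; lra.
have Ky0 : 0 <= K / y by rewrite divr_ge0//; lra.
have h : K / y * (1 + Ni) <= 201 / 1000 * (101 / 100) by apply: ler_pM => //; lra.
set A := 61 / 50 + _ * _.
have hA : A <= 61 / 50 + 7 / 6 * (201 / 1000 * (101 / 100)) by rewrite /A -mulrA; move: (_ * (1 + Ni)) h => w; clear; lra.
have : ly * A <= ln (5 * K) * (61 / 50 + 7 / 6 * (201 / 1000 * (101 / 100))).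
  apply: ler_pM => //; rewrite /A -mulrA.
  have : 0 <= K / y * (1 + Ni) by apply: mulr_ge0 => //; lra.
  by move: (_ * (1 + Ni)) => w; clear; lra.
have -> : 100 / 21 * (47 / 20 * ly) * A = 100 / 21 * (47 / 20) * (ly * A) by ring.
rewrite l5; move: L6 l2 l54; move: (ly * A) (ln (2 * K)) (@ln R 2) (@ln R (5 / 4)) => a b c d; clear; lra.
Qed.

Lemma finite_version n (u : 'I_n -> R[i]) (x : 'I_n -> R) (delta N : R) (M : nat)
    (F1 := \sum_i nc (u i)) (F2 := \sum_i nc (u i) ^+ 2) :
  10 ^+ 4 <= N -> M%:R <= N -> 0 < delta -> spaced delta x -> 0 < F2 ->
  \sum_(0 <= p < M.+1 | prime p) nc (expsum u x p%:R) ^+ 2 <=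
  19 * (N + delta^-1) * F2 * (ln (2 * F1 ^+ 2 / F2) / ln N).
Proof.
move=> N4 MN d0 sep F20.
have N100 : 100 <= N by apply: le_trans N4; lra.
have N0 : 0 < N by apply: lt_le_trans N100.
have nu0 : 0 < ln N by apply: ln_gt0; apply: lt_le_trans N100; lra.
have D0 : 0 < delta^-1 by rewrite invr_gt0.
have ND : 0 < N + delta^-1 by rewrite addr_gt0.
have F10 : 0 <= F1 by apply: sumr_ge0 => i _; exact: normc_ge0.
pose K := F1 ^+ 2 / F2.
have FK : F1 ^+ 2 = K * F2 by rewrite divfK// lt0r_neq0.
have KF0 : 0 <= K * F2 by rewrite -FK; exact: sqr_ge0.
have K1 : 1 <= K.
  rewrite ler_pdivlMr// mul1r /F2 expr2 {1}/F1 mulr_suml; apply: ler_sum => i _.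
  rewrite expr2 ler_wpM2l ?normc_ge0// /F1 (bigD1 i)//= lerDl sumr_ge0// => j _.
  exact: normc_ge0.
rewrite -[2 * _ / F2]mulrA -/K mulrA ler_pdivlMr//.
set T := \sum_(_ <= _ < _ | _) _.
have T0 : 0 <= T by apply: sumr_ge0 => p _; exact: sqr_ge0.
suff : T * ln N <= 19 * ln (2 * K) * ((N + delta^-1) * F2) by rewrite [leRHS](_ : _ = 19 * (N + delta^-1) * F2 * ln (2 * K)); last ring.
have PF : 0 < (N + delta^-1) * F2 by rewrite mulr_gt0.
have [K24|K24] := leP K 24.
  have h1 : T <= (Num.sqrt N + 2 * ln 4 * N / ln N) * (K * F2).
    apply: le_trans (_ : (\sum_(0 <= p < M.+1 | prime p) 1) * F1 ^+ 2 <= _).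
      rewrite mulr_suml; apply: ler_sum => p _; rewrite mul1r lerXn2r ?nnegrE ?normc_ge0//.
      exact: normc_expsum_le.
    rewrite FK; apply: ler_wpM2r => //.
    by apply: prime_count_le => //; apply: lt_le_trans N100; lra.
  have l4 : ln 4 <= 25 / 18 :> R.
    have -> : 4 = 2 ^+ 2 :> R by lra.
    by rewrite lnXn// -[ln 2 *+ 2]mulr_natr; have /andP[_] := @ln2_bounds R; lra.
  have h2 : (Num.sqrt N + 2 * ln 4 * N / ln N) * ln N <= (25 / 9 + 187 / 2000) * N.
    rewrite mulrDl divfK ?lt0r_neq0//.
    have s1 : Num.sqrt N * ln N <= 187 / 2000 * N.
      rewrite -{3}(sqr_sqrtr (ltW N0)) expr2 mulrCA ler_wpM2l ?sqrtr_ge0//; exact: ln_le_sqrt.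
    have s2 : ln 4 * N <= 25 / 18 * N by rewrite ler_pM2r.
    by rewrite -[2 * ln 4 * N]mulrA; move: s1 s2; move: (Num.sqrt N * _) (@ln R 4 * N) => a b; clear; lra.
  apply: le_trans (_ : (25 / 9 + 187 / 2000) * N * (K * F2) <= _).
    apply: le_trans (_ : (Num.sqrt N + 2 * ln 4 * N / ln N) * (K * F2) * ln N <= _).
      by rewrite ler_pM2r.
    by rewrite mulrAC; apply: ler_wpM2r.
  apply: le_trans (_ : 19 * ln (2 * K) * (N * F2) <= _).
    have -> : (25 / 9 + 187 / 2000) * N * (K * F2) = (25 / 9 + 187 / 2000) * K * (N * F2) by ring.
    by rewrite ler_wpM2r ?chebyshev_numeric// mulr_ge0// ltW.
  apply: ler_wpM2l; last by rewrite ler_wpM2r ?(ltW F20)// lerDl ltW.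
  by rewrite mulr_ge0// ln_ge0//; lra.
have [big|small] := leP (61 / 50 * ln N) (19 * ln (2 * K)).
  apply: le_trans (_ : 61 / 50 * (N + delta^-1) * F2 * ln N <= _).
    rewrite ler_pM2r//; apply: le_trans (large_sieve_uniform _ _ _ u _ _ d0 sep N100 MN).
    by rewrite /T big_mkcond; apply: ler_sum => p _; case: ifP => _ //; exact: sqr_ge0.
  have -> : 61 / 50 * (N + delta^-1) * F2 * ln N = 61 / 50 * ln N * ((N + delta^-1) * F2) by ring.
  by rewrite ler_pM2r.
have small' := ltW small; have K24' := ltW K24.
have Ni0 : 0 <= N^-1 by rewrite invr_ge0 ltW.
have Ni1 : N^-1 <= 1 / 100 by rewrite mul1r lef_pV2 ?posrE.
(* For moderate K the constant 47/20 is too lossy, so y is fixed at 256 with the computed product;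
   the term in K / 256 rules this out for much larger K. *)
have [K250|K250] := leP K 250.
  have K48 : 48 <= 2 * K by clear -K24'; lra.
  have h := @sieve_bound_ln R n u x delta N K (997 / 100) 3 M 256 d0 sep N100 MN K24' FK small'.
  apply: le_trans (h _ _ _ _ _ _) _ => //.
  - by apply: le_trans (_ : 48 ^+ 2 <= _); [clear; lra|rewrite lerXn2r ?nnegrE//; clear -K48; lra].
  - exact: prod_prime_sub1_256.
  - by have := @ln_256_ge R; clear; lra.
  - apply: eps_small small' _.
    by apply: le_trans (ln_mono_pow2 48 (2 * K) 5 _ _) => //; clear; lra.
  rewrite -mulrA ler_pM2r//; exact: sieve_numeric_small.
have K250' := ltW K250.
pose y := Num.truncn (5 * K).
have /andP[y1 y2] : y%:R <= 5 * K < y.+1%:R by apply: truncn_itv; lra.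
have y256 : (256 <= y)%N.
  by rewrite -ltnS -(ltr_nat R); apply: le_lt_trans y2; lra.
have h := @sieve_bound_ln R n u x delta N K (47 / 20 * ln y%:R) 1 M y d0 sep N100 MN K24' FK small'.
apply: le_trans (h _ _ _ _ _ _) _ => //.
- by apply: le_trans y1 _; nra.
- exact: prod_prime_sub1_le.
- apply: eps_large small' _.
  by apply: le_trans (ln_mono_pow2 500 (2 * K) 9 _ _); lra.
rewrite -mulrA ler_pM2r//; apply: sieve_numeric_large => //.
- by rewrite natr1 ltW.
- exact: ln_nat_ge0.
- by rewrite ler_ln ?posrE ?ltr0n ?(leq_trans _ y256)//; lra.
Qed.

End FiniteVersion.

Local Open Scope classical_set_scope.
Local Open Scope ring_scope.

(** * From the circle to real representatives *)

Section Circle.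
Context {R : realType}.
Implicit Types (x y : circle R) (B : set (circle R)).

Lemma toCircle_repr x : toCircle (repr x) = x.
Proof. by rewrite /toCircle reprK. Qed.

Lemma circle_dist_le x y (k : int) : circle_dist x y <= `|repr x - repr y - k%:~R|.
Proof.
apply: ge_inf; first by exists 0 => _ [s _ [t _ <-]].
exists (repr x); first exact: toCircle_repr.
exists (repr y + k%:~R); last by rewrite opprD addrA.
rewrite /preimage /= -[RHS]toCircle_repr; apply/toCircle_eq; exists k.
by rewrite addrAC subrr add0r.
Qed.

(* The points of [B] fall into distinct cells when the unit interval is cut
   into cells of length [delta]. *)
Lemma well_spaced_finite (delta : R) B : 0 < delta -> well_spaced delta B -> finite_set B.
Proof.
move=> d0 wB.
pose r x := (repr x - (Num.floor (repr x))%:~R) / delta.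
have r0 x : 0 <= r x by rewrite divr_ge0 ?subr_ge0 ?floor_le_tmp// ltW.
have r1 x : r x <= delta^-1.
  rewrite ler_pdivrMr// mulVf ?gt_eqF// lerBlDr addrC ltW//.
  by have := @floorD1_gt R (repr x); rewrite intrD.
pose key x := Num.truncn (r x).
have key_inj x y : B x -> B y -> key x = key y -> x = y.
  move=> Bx By kxy; apply/eqP; apply/negP => /negP xy.
  have /(le_trans (wB x y Bx By xy)) := circle_dist_le x y (Num.floor (repr x) - Num.floor (repr y)).
  apply/negP; rewrite -ltNge.
  have /andP[x1 x2] := truncn_itv (r0 x); have /andP[y1 y2] := truncn_itv (r0 y).
  have -> : repr x - repr y - (Num.floor (repr x) - Num.floor (repr y))%:~R = (r x - r y) * delta.
    by rewrite mulrBl !divfK ?gt_eqF// intrB; ring.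
  rewrite normrM (gtr0_norm d0) -[ltRHS]mul1r ltr_pM2r// ltr_norml.
  move: x1 x2 y1 y2; rewrite -/(key x) -/(key y) kxy -!natr1.
  by move: (r x) (r y) (_%:R) => a b c; clear; lra.
pose m := (Num.truncn delta^-1).+1.
apply: (@sub_finite_set _ _ ((fun n => xget 0 [set x | B x /\ key x = n]) @` `I_m)); last first.
  exact: finite_image (finite_II _).
move=> x Bx; exists (key x).
  by rewrite /m /= ltnS le_truncn.
case: xgetP => [y _ [By kyx]|/(_ x)[]//].
exact: key_inj.
Qed.

End Circle.

Theorem theorem7 (R : realType) (N delta : R) (B : set (circle R))
    (f : circle R -> R[i]) :
  10 ^+ 4 <= N ->
  0 < delta ->
  well_spaced delta B ->
  (exists2 b, B b & f b != 0) ->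
  \sum_(0 <= p < (Num.truncn N).+1 | prime p)
      Normc.normc (\sum_(b \in B) f b * e (b *+ p)) ^+ 2
    <= 19 * (N + delta^-1) * lnorm 2 B f ^+ 2
       * (ln (2 * lnorm 1 B f ^+ 2 / lnorm 2 B f ^+ 2) / ln N).
Proof.
move=> N4 d0 wB [b0 Bb0 fb0].
have finB := well_spaced_finite delta B d0 wB.
pose s := finmap.enum_fset (fset_set B).
have sP b : (b \in s) -> B b by rewrite in_fset_set// inE.
pose b i := tnth (in_tuple s) i.
have bB i : B (b i) by apply: sP; exact: mem_tnth.
have b_inj : injective b by apply/tuple_uniqP; exact: finmap.fset_uniq.
have sumB (V : zmodType) (g : circle R -> V) : \sum_(c \in B) g c = \sum_i g (b i).
  by rewrite (fsbig_finite _ _ finB); exact: big_tnth.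
rewrite lnorm1 sqr_lnorm2 !sumB.
(* b *+ p is the class of p times the representative of b, so by periodicity the character can be
   evaluated at that real number. *)
under eq_bigr => p _.
  rewrite sumB.
  under eq_bigr => i _ do rewrite -{2}(toCircle_repr (b i)) toCircleMn e_toCircle -mulr_natr.
  over.
apply: (finite_version _ (f \o b) (repr \o b)) => //.
- by rewrite truncn_le (le_trans _ N4)// exprn_ge0.
- move=> i j ij k; apply: le_trans (circle_dist_le _ _ k).
  by apply: wB => //; rewrite (inj_eq b_inj).
have /tnthP[i0 bi0] : b0 \in in_tuple s by rewrite in_fset_set// inE.
rewrite (bigD1 i0)//= ltr_wpDr//.
  by apply: sumr_ge0 => i _; exact: sqr_ge0.
rewrite /b -bi0 exprn_gt0// lt_def normc_ge0 andbT.
by apply: contraNneq fb0 => /Normc.eq0_normc ->.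
Qed.
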